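(* Let $G=(V,E)$ be a weighted graph with measure $\mu$ satisfying the standing assumptions given in the context, and let $K\in\mathbb{R}$. Then the condition $CDE'(\infty,-K)$ holds if and only if for every positive bounded function $0<f\in\ell^\infty(V,\mu)$ and every $t\ge 0$, $$\Gamma(\sqrt{P_{t}f}) \leq e^{2Kt}P_{t}(\Gamma(\sqrt{f}))\quad\text{pointwise on }V.$$
   Context: Standing assumptions. $G=(V,E)$ is a connected (finite or infinite) graph with symmetric weight $\omega:V\times V\to[0,\infty)$, $\omega_{xy}=\omega_{yx}$, where $x\sim y$ (i.e. $xy$ is an edge) iff $\omega_{xy}>0$; $\omega_{\min}=\inf_{x\sim y}\omega_{xy}>0$; $G$ is locally finite, $m(x):=\sum_{y\sim x}\omega_{xy}<\infty$ for all $x$. $\mu:V\to(0,\infty)$ is a measure with $D_\mu:=\sup_{x\in V} m(x)/\mu(x)<\infty$. $\ell^\infty(V,\mu)$ is the space of bounded real functions on $V$ with the sup norm. Laplacian: $\Delta f(x)=\frac1{\mu(x)}\sum_{y\sim x}\omega_{xy}(f(y)-f(x))$. Gradient form: $2\Gamma(f,g)=\Delta(fg)-f\Delta g-g\Delta f$, i.e. $2\Gamma(f,g)(x)=\frac1{\mu(x)}\sum_{y\sim x}\omega_{xy}(f(y)-f(x))(g(y)-g(x))$, $\Gamma(f)=\Gamma(f,f)$. For positive $f:V\to(0,\infty)$, $\widetilde{\Gamma}_2(f)=\frac12\Delta\Gamma(f)-\Gamma\!\left(f,\frac{\Delta (f^2)}{2f}\right)$. $CDE'(n,K)$: for every positive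 function $f:V\to(0,\infty)$ and every $x\in V$, $\widetilde{\Gamma}_2(f)(x)\ge\frac1n f(x)^2\big((\Delta\log f)(x)\big)^2+K\Gamma(f)(x)$. For $n=\infty$ one sets $\frac1n=0$, so $CDE'(\infty,-K)$ says $\widetilde{\Gamma}_2(f)\ge -K\Gamma(f)$ pointwise for every positive $f$. Heat semigroup: for a finite $U\subset V$ let $\overset{\circ}{U}=\{x\in U: y\in U\text{ for all }y\sim x\}$, let $\Delta_U$ be the Dirichlet Laplacian on $\ell^2(\overset{\circ}{U},\mu)$ (extend by $0$ outside $\overset{\circ}{U}$, apply $\Delta$, restrict to $\overset{\circ}{U}$), and let $p_U(t,x,y)=\sum_i e^{-\lambda_i t}\phi_i(x)\phi_i(y)$ for $x,y\in\overset{\circ}{U}$, where $(\phi_i)$ is an $\ell^2(\overset{\circ}{U},\mu)$-orthonormal basis of eigenfunctions of $-\Delta_U$ with eigenvalues $\lambda_i$; extend $p_U$ by $0$ to $V\times V$. For an exhaustion of $V$ by finite sets $U_k$ with $U_k\subset\overset{\circ}{U}_{k+1}$, $\bigcup_k U_k=V$, the heat kernel is $p_t(x,y)=\lim_{k\to\infty}p_{U_k}(t,x,y)$ (independent of the exhaustion). For $f\in\ell^\infty(V,\mu)$ and $t>0$, $P_tf(x)=\sum_{y\in V}\mu(y)p_t(x,y)f(y)$, and $P_0f=f$. *)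

(* Defs.v *)
From HB Require Import structures.
From mathcomp Require Import all_boot all_order all_algebra.
From mathcomp Require Import all_classical all_reals all_analysis.

Set Implicit Arguments.
Unset Strict Implicit.
Unset Printing Implicit Defensive.

Import Order.TTheory GRing.Theory Num.Theory.
Import numFieldNormedType.Exports.

Local Open Scope classical_set_scope.
Local Open Scope ring_scope.

(* A weighted graph on V is given by its weight w : V -> V -> R; x and y are
   adjacent iff 0 < w x y.  Loops are allowed: they contribute to the weighted
   degree but not to the Laplacian. *)
Section WeightedGraph.
Context {R : realType} {V : choiceType}.
Implicit Types (w : V -> V -> R) (mu f g : V -> R).

Definition neighbours w (x : V) : set V := [set y | 0 < w x y].

Definition degree w (x : V) : R := \sum_(y \in neighbours w x) w x y.

Definition min_weight w : \bar R :=
  ereal_inf [set (w e.1 e.2)%:E | e in [set e : V * V | 0 < w e.1 e.2]].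

Definition max_degree_ratio w mu : \bar R :=
  ereal_sup [set (degree w x / mu x)%:E | x in [set: V]].

(* Local finiteness makes every sum over [neighbours w x] a genuine finite sum;
   in particular the degree is finite. *)
Record weighted_graph w mu : Prop := WeightedGraph {
  weight_ge0 : forall x y, 0 <= w x y;
  weight_sym : forall x y, w x y = w y x;
  graph_connected : forall x y,
    exists s : seq V, path (fun a b => 0 < w a b) x s /\ last x s = y;
  min_weight_gt0 : (0 < min_weight w)%E;
  locally_finite : forall x, finite_set (neighbours w x);
  vertex_measure_gt0 : forall x, 0 < mu x;
  max_degree_ratio_lty : (max_degree_ratio w mu < +oo)%E }.

Definition laplacian w mu f (x : V) : R :=
  (mu x)^-1 * \sum_(y \in neighbours w x) w x y * (f y - f x).

Definition Gamma w mu f g (x : V) : R :=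
  2^-1 * (laplacian w mu (fun y => f y * g y) x
          - f x * laplacian w mu g x - g x * laplacian w mu f x).

Definition Gamma2_tilde w mu f (x : V) : R :=
  2^-1 * laplacian w mu (Gamma w mu f f) x
  - Gamma w mu f
      (fun y => laplacian w mu (fun z => f z ^+ 2) y / (2 * f y)) x.

(* The dimension n ranges over ]0, +oo]; the inverse of \bar R satisfies
   +oo^-1 = 0. *)
Definition CDE' w mu (n : \bar R) (K : R) : Prop :=
  forall f, (forall x, 0 < f x) -> forall x,
    fine (n^-1)%E * f x ^+ 2 * laplacian w mu (fun y => ln (f y)) x ^+ 2
      + K * Gamma w mu f f x <= Gamma2_tilde w mu f x.

Definition inner w (U : set V) : set V :=
  [set x | U x /\ neighbours w x `<=` U].

(* Functions on [inner w U] are represented by functions on V that vanish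
   outside [inner w U]; [f \_ A] is f on A and 0 elsewhere. *)
Definition dirichlet_laplacian w mu (U : set V) f : V -> R :=
  (laplacian w mu (f \_ (inner w U))) \_ (inner w U).

Definition inner_product mu (A : set V) f g : R :=
  \sum_(x \in A) mu x * f x * g x.

Definition dirichlet_eigenbasis w mu (U : set V) (n : nat)
    (lambda : 'I_n -> R) (phi : 'I_n -> V -> R) : Prop :=
  [/\ forall i x, ~ inner w U x -> phi i x = 0,
      forall i x, - dirichlet_laplacian w mu U (phi i) x = lambda i * phi i x,
      forall i j, inner_product mu (inner w U) (phi i) (phi j) = (i == j)%:R
    & forall f, (forall x, ~ inner w U x -> f x = 0) ->
        exists c : 'I_n -> R, forall x, f x = \sum_(i < n) c i * phi i x].

Definition is_dirichlet_heat_kernel w mu (U : set V) (p : R -> V -> V -> R) :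
    Prop :=
  exists (n : nat) (lambda : 'I_n -> R) (phi : 'I_n -> V -> R),
    dirichlet_eigenbasis w mu U lambda phi /\
    forall t x y,
      p t x y = \sum_(i < n) expR (- lambda i * t) * phi i x * phi i y.

(* For finite U such a kernel exists and does not depend on the eigenbasis. *)
Definition dirichlet_heat_kernel w mu (U : set V) : R -> V -> V -> R :=
  xget (fun _ _ _ => 0) [set p | is_dirichlet_heat_kernel w mu U p].

Definition exhaustion w (U : nat -> set V) : Prop :=
  [/\ forall k, finite_set (U k),
      forall k, U k `<=` inner w (U k.+1)
    & \bigcup_k U k = [set: V]].

(* The common limit of the Dirichlet heat kernels along all exhaustions. *)
Definition heat_kernel w mu (t : R) (x y : V) : R :=
  xget 0 [set l | forall U, exhaustion w U ->
    dirichlet_heat_kernel w mu (U k) t x y @[k --> \oo] --> l].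

(* Sum of an absolutely summable real family: \esum is only meant for
   nonnegative families, hence the positive and negative parts. *)
Definition real_sum f : R :=
  fine (\esum_(y in [set: V]) (Num.max (f y) 0)%:E
        - \esum_(y in [set: V]) (Num.max (- f y) 0)%:E)%E.

Definition heat_semigroup w mu (t : R) f (x : V) : R :=
  if t == 0 then f x
  else real_sum (fun y => mu y * heat_kernel w mu t x y * f y).

End WeightedGraph.

(* Main.v *)
(** Since D_mu is finite, the Laplacian L is bounded on bounded functions:
    with c >= D_mu, the operator B = L + c is positive and B 1 = c, so
    P_t = e^(-ct) sum_j (t^j/j!) B^j is a Markov semigroup.  It is the heat
    semigroup: (B^j f)(x) depends only on f near x, so the Dirichlet kernels,
    which have the same expansion with B killed outside the interior of U_k,
    agree with P_t up to the tail of the exponential series.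

    Write g = sqrt u.  For any v = u + h L u + O(h^2),
      Gamma (sqrt v) = Gamma g + 2 h Gamma (g, L (g^2) / (2 g)) + O(h^2),
    uniformly when u is bounded and bounded away from 0.  Under the curvature
    condition, one Euler step Q = 1 + h L therefore satisfies
      Gamma (sqrt (Q u)) <= e^(2Kh) Q (Gamma (sqrt u)) + O(h^2);
    iterating n times with h = t/n and letting n -> oo gives the gradient
    estimate, because Q^n tends to P_t.  A positive f is replaced by f + eps:
    P_t (f + eps) = P_t f + eps, and Gamma (sqrt (f + eps)) <= Gamma (sqrt f).
    Conversely, the expansion at t = 0 of the gradient estimate for P_t g^2 is
    the curvature inequality, which at x only involves g on the ball of radius
    2, so that g may be assumed equal to 1 elsewhere. *)

Require Import Defs.
From HB Require Import structures.
From mathcomp Require Import all_boot all_order all_algebra finmap.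
From mathcomp Require Import all_classical all_reals all_analysis.
From mathcomp Require Import ring lra complex.

Set Implicit Arguments.
Unset Strict Implicit.
Unset Printing Implicit Defensive.

Import Order.TTheory GRing.Theory Num.Theory.
Import numFieldNormedType.Exports.

Local Open Scope classical_set_scope.
Local Open Scope ring_scope.

(** * Exponential generating functions *)

Section ExponentialGeneratingFunction.
Context {R : realType}.
Implicit Types (a b : nat -> R) (c M t : R).

Definition egf a t : R := limn (pseries (fun j => a j / j`!%:R) t).

(** In the applications [a j] is $(B^j f)(x)$, where [M] bounds $|f|$ and [c] bounds the norm of
    $B$; such series converge for every [t]. *)
Definition geometrically_bounded M c a := forall j, `|a j| <= M * c ^+ j.

Lemma pseries_expR t : pseries (fun j => j`!%:R^-1) t @ \oo --> expR t.
Proof.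
rewrite expRE.
have := is_cvg_series_exp_coeff t.
by rewrite exp_coeffE.
Qed.

Lemma pseries_expR_scale c t :
  pseries (fun j => c ^+ j / j`!%:R) t = pseries (fun j => j`!%:R^-1) (c * t).
Proof.
congr series; apply/funext => j /=.
by rewrite exprMn mulrA [_^-1 * _]mulrC.
Qed.

Lemma cvg_egf M c a t : 0 <= c -> geometrically_bounded M c a ->
  pseries (fun j => a j / j`!%:R) t @ \oo --> egf a t.
Proof.
move=> c0 aM.
apply: (@normed_cvg R R^o).
have M0 : 0 <= M by have := aM 0%N; rewrite expr0 mulr1; apply: le_trans.
apply: (@series_le_cvg _ _ (M *: (fun j => (c * `|t|) ^+ j / j`!%:R))).
- by move=> j /=; exact: normr_ge0.
- by move=> j /=; rewrite mulr_ge0// divr_ge0// exprn_ge0// mulr_ge0.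
- move=> j /=; rewrite !normrM normfV normrX (ger0_norm (ler0n _ _)).
  rewrite [leRHS](_ : _ = M * c ^+ j / j`!%:R * `|t| ^+ j); last first.
    by rewrite -[LHS]/(M * ((c * `|t|) ^+ j / j`!%:R)) exprMn; ring.
  by rewrite ler_wpM2r ?exprn_ge0// ler_wpM2r ?invr_ge0.
- apply: is_cvg_seriesZ.
  have := is_cvg_series_exp_coeff (c * `|t|).
  by rewrite /exp_coeff.
Qed.

Lemma is_cvg_egf M c a t : 0 <= c -> geometrically_bounded M c a ->
  cvgn (pseries (fun j => a j / j`!%:R) t).
Proof. by move=> c0 aM; apply/cvg_ex; exists (egf a t); exact: cvg_egf c0 aM. Qed.

Lemma egf_geom c t : egf (fun j => c ^+ j) t = expR (c * t).
Proof.
rewrite /egf pseries_expR_scale; apply/cvg_lim => //; exact: pseries_expR.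
Qed.

Lemma egf_linear M N c a b (k l t : R) : 0 <= c ->
  geometrically_bounded M c a -> geometrically_bounded N c b ->
  egf (fun j => k * a j + l * b j) t = k * egf a t + l * egf b t.
Proof.
move=> c0 aM bN; apply/cvg_lim => //.
rewrite (_ : pseries _ t = (fun n => k * pseries (fun j => a j / j`!%:R) t n
   + l * pseries (fun j => b j / j`!%:R) t n)); last first.
  apply/funext => n; rewrite /pseries /series /= !mulr_sumr -big_split /=.
  by apply: eq_bigr => j _; ring.
by apply: cvgD; apply: cvgMr; apply: cvg_egf; eauto.
Qed.

Lemma egf_sum (I : Type) (r : seq I) (k : I -> R) (a : I -> nat -> R) M c t :
  0 <= c -> (forall i, geometrically_bounded M c (a i)) ->
  egf (fun j => \sum_(i <- r) k i * a i j) t = \sum_(i <- r) k i * egf (a i) t.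
Proof.
move=> c0 aM; apply/cvg_lim => //.
rewrite (_ : pseries _ t = (fun n => \sum_(i <- r)
    k i * pseries (fun j => a i j / j`!%:R) t n)); last first.
  apply/funext => n; rewrite /pseries /series /=.
  under eq_bigr do rewrite !mulr_suml.
  rewrite exchange_big /=; apply: eq_bigr => i _; rewrite mulr_sumr.
  by apply: eq_bigr => j _; ring.
apply: cvg_big => [|i _]; first exact: add_continuous.
by apply: cvgMr; apply: cvg_egf; eauto.
Qed.

Lemma ler_egf M N c a b t : 0 <= c -> 0 <= t ->
  geometrically_bounded M c a -> geometrically_bounded N c b ->
  (forall j, a j <= b j) -> egf a t <= egf b t.
Proof.
move=> c0 t0 aM bN ab; apply: ler_lim.
- exact: is_cvg_egf c0 aM.
- exact: is_cvg_egf c0 bN.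
- near=> n; rewrite /pseries /series /=; apply: ler_sum => j _.
  by rewrite ler_wpM2r ?exprn_ge0// ler_wpM2r ?invr_ge0.
Unshelve. all: end_near. Qed.

Lemma egf_geomM M c t : egf (fun j => M * c ^+ j) t = M * expR (c * t).
Proof.
apply/cvg_lim => //.
rewrite (_ : pseries _ t =
    (fun n => M * pseries (fun j => c ^+ j / j`!%:R) t n)); last first.
  apply/funext => n; rewrite /pseries /series /= mulr_sumr.
  by apply: eq_bigr => j _; ring.
by rewrite pseries_expR_scale; apply: cvgMr; exact: pseries_expR.
Qed.

Lemma normr_le_egf M c a b t : 0 <= c -> 0 <= t ->
  geometrically_bounded M c b -> (forall j, `|a j| <= b j) ->
  `|egf a t| <= egf b t.
Proof.
move=> c0 t0 bM ab.
have aM : geometrically_bounded M c a.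
  by move=> j; rewrite (le_trans (ab j))// (le_trans (ler_norm _)).
have aN : geometrically_bounded M c (fun j => -1 * a j + 0 * a j).
  by move=> j; rewrite mul0r addr0 mulN1r normrN.
rewrite ler_norml; apply/andP; split.
  have <- : - egf (fun j => -1 * a j + 0 * a j) t = egf a t.
    by rewrite (egf_linear _ _ _ c0 aM aM) mul0r addr0 mulN1r opprK.
  rewrite lerN2; apply: ler_egf aN bM _ => // j.
  by rewrite mul0r addr0 mulN1r (le_trans _ (ab j))// -normrN ler_norm.
by apply: ler_egf aM bM _ => // j; rewrite (le_trans (ler_norm _)).
Qed.

Lemma normr_egf M c a t : 0 <= c -> 0 <= t -> geometrically_bounded M c a ->
  `|egf a t| <= M * expR (c * t).
Proof.
move=> c0 t0 aM; rewrite -egf_geomM; apply: (normr_le_egf (M := M) c0) => // j.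
have M0 : 0 <= M by have := aM 0%N; rewrite expr0 mulr1; apply: le_trans.
by rewrite ger0_norm// mulr_ge0// exprn_ge0.
Qed.

Definition exp_tail (x : R) n := expR x - pseries (fun j => j`!%:R^-1) x n.

Lemma cvg_exp_tail x : exp_tail x @ \oo --> 0.
Proof.
rewrite -(subrr (expR x)); apply: cvgB; first exact: cvg_cst.
exact: pseries_expR.
Qed.

(** The remainder of order [n] is itself an exponential generating function, with its first [n]
    coefficients set to 0, so the comparison lemmas apply to remainders. *)
Lemma egf_drop M c a t n : 0 <= c -> geometrically_bounded M c a ->
  egf (fun j => if (j < n)%N then 0 else a j) t
    = egf a t - pseries (fun j => a j / j`!%:R) t n.
Proof.
move=> c0 aM; apply/cvg_lim => //.
have : pseries (fun j => a j / j`!%:R) t m - pseries (fun j => a j / j`!%:R) t n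
    @[m --> \oo] --> egf a t - pseries (fun j => a j / j`!%:R) t n.
  by apply: cvgB; [apply: cvg_egf; eauto | exact: cvg_cst].
apply: cvg_trans; apply: near_eq_cvg; near=> m.
have nm : (n <= m)%N by near: m; exact: nbhs_infty_ge.
rewrite /pseries /series /= (big_cat_nat (leq0n n) nm)//= addrAC subrr add0r.
rewrite [RHS](big_cat_nat (leq0n n) nm)//= [X in _ = X + _]big_nat_cond.
rewrite [X in _ = X + _]big1 ?add0r.
  by apply: eq_big_nat => j /andP[nj _]; rewrite ltnNge nj.
by move=> j /andP[/andP[_ ->]] _; rewrite !mul0r.
Unshelve. all: end_near. Qed.

Lemma normr_egf_tail M c a t n : 0 <= c -> 0 <= t ->
  geometrically_bounded M c a ->
  `|egf a t - pseries (fun j => a j / j`!%:R) t n| <= M * exp_tail (c * t) n.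
Proof.
move=> c0 t0 aM; rewrite -(egf_drop _ _ c0 aM).
have M0 : 0 <= M by have := aM 0%N; rewrite expr0 mulr1; apply: le_trans.
have gM : geometrically_bounded M c (fun j => M * c ^+ j).
  by move=> j; rewrite ger0_norm// mulr_ge0// exprn_ge0.
rewrite /exp_tail mulrBr -egf_geomM -pseries_expR_scale.
rewrite (_ : M * pseries _ t n = pseries (fun j => M * c ^+ j / j`!%:R) t n).
  rewrite -(egf_drop _ _ c0 gM); apply: (normr_le_egf (M := M) c0) => // j.
    case: ifP => _; last exact: gM.
    by rewrite normr0 mulr_ge0// exprn_ge0.
  by case: ifP => _; [rewrite normr0|exact: aM].
rewrite /pseries /series /= mulr_sumr; apply: eq_bigr => j _; ring.
Qed.

(** The partial sums of order [n] cancel, leaving two remainders, each at most [M] times the tail of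
    $e^{ct}$. *)
Lemma egf_agree M c a b t n : 0 <= c -> 0 <= t ->
  geometrically_bounded M c a -> geometrically_bounded M c b ->
  (forall j, (j < n)%N -> a j = b j) ->
  `|egf a t - egf b t| <= 2 * M * exp_tail (c * t) n.
Proof.
move=> c0 t0 aM bM ab.
have := normr_egf_tail n c0 t0 aM; have := normr_egf_tail n c0 t0 bM.
have -> : pseries (fun j => b j / j`!%:R) t n
    = pseries (fun j => a j / j`!%:R) t n.
  by apply: eq_big_nat => j /andP[_ /ab] /= ->.
set S := pseries _ t n => Hb Ha.
have -> : egf a t - egf b t = (egf a t - S) - (egf b t - S) by ring.
by rewrite (le_trans (ler_normB _ _))// -mulrA mulr_natl mulr2n lerD.
Qed.

(** Termwise differentiation shifts the coefficients, as $(j+1)a_{j+1}/(j+1)! = a_{j+1}/j!$. The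
    sequences shifted once and twice remain geometrically bounded, hence converge at the radius
    $|t|+1$. *)
Lemma is_derive_egf M c a t : 0 <= c -> geometrically_bounded M c a ->
  is_derive t 1 (egf a) (egf (fun j => a j.+1) t).
Proof.
move=> c0 aM.
have diffs b : pseries_diffs (fun j => b j / j`!%:R)
    = (fun j => b j.+1 / j`!%:R) :> (nat -> R).
  apply/funext => j; rewrite /pseries_diffs factS natrM invfM mulrCA mulVKf//.
have shiftb b N : geometrically_bounded N c b ->
    geometrically_bounded (N * c) c (fun j => b j.+1).
  by move=> bN j; rewrite -mulrA -exprS.
rewrite /egf -diffs; apply: (@pseries_snd_diffs _ _ (`|t| + 1)).
- exact: is_cvg_egf c0 aM.
- by rewrite diffs; apply: is_cvg_egf c0 (shiftb _ _ aM).
- by rewrite !diffs; apply: is_cvg_egf c0 (shiftb _ _ (shiftb _ _ aM)).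
- by rewrite [ltRHS]ger0_norm ?addr_ge0// ltrDl.
Qed.

End ExponentialGeneratingFunction.

(** * Bounded Markov generators *)

Section Generator.
Context {R : realType} {V : choiceType}.
(** [N x] lists the targets of the jumps from [x] and [a x y] is a jump rate; for the graph it will
    be $\omega_{xy}/\mu(x)$, with $c \ge D_\mu$. *)
Variables (N : V -> seq V) (a : V -> V -> R) (c : R).
Hypothesis c_ge0 : 0 <= c.
Hypothesis a_ge0 : forall x y, 0 <= a x y.
Hypothesis sum_a_le : forall x, \sum_(y <- N x) a x y <= c.
Implicit Types (f g u : V -> R) (x y : V) (A : set V) (M k l t h : R).

Definition gen f x := \sum_(y <- N x) a x y * (f y - f x).
Definition shifted_gen f x := gen f x + c * f x.
Definition semigroup t f x :=
  expR (- (c * t)) * egf (fun j => iter j shifted_gen f x) t.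
Definition euler_step h f x := f x + h * gen f x.
Definition carre_du_champ f g x :=
  2^-1 * \sum_(y <- N x) a x y * ((f y - f x) * (g y - g x)).

Local Notation B := shifted_gen.
Local Notation P := semigroup.
Local Notation Q := euler_step.

(** * Positivity and contraction of the semigroup *)

Definition bounded_by M f := forall x, `|f x| <= M.

Lemma bounded_by_ge0 M f x : bounded_by M f -> 0 <= M.
Proof. by move=> /(_ x); apply: le_trans. Qed.

Lemma gen_linear k l f g :
  gen (fun x => k * f x + l * g x) = (fun x => k * gen f x + l * gen g x).
Proof.
apply/funext => x; rewrite /gen !mulr_sumr -big_split /=.
by apply: eq_bigr => y _; ring.
Qed.

Lemma gen_cst k : gen (fun=> k) = (fun=> 0).
Proof. by apply/funext => x; apply: big1 => y _; rewrite subrr mulr0. Qed.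

(** Collecting the diagonal terms shows that all coefficients of $B$ are nonnegative, whence its
    monotonicity. *)
Lemma shifted_genE f x :
  B f x = \sum_(y <- N x) a x y * f y + (c - \sum_(y <- N x) a x y) * f x.
Proof.
have genE : gen f x =
    \sum_(y <- N x) a x y * f y - (\sum_(y <- N x) a x y) * f x.
  by rewrite mulr_suml -sumrB; apply: eq_bigr => y _; rewrite mulrBr.
by rewrite /B genE; ring.
Qed.

Lemma shifted_gen_linear k l f g :
  B (fun x => k * f x + l * g x) = (fun x => k * B f x + l * B g x).
Proof. by apply/funext => x; rewrite /B gen_linear; ring. Qed.

Lemma shifted_gen_cst k : B (fun=> k) = (fun=> c * k).
Proof. by apply/funext => x; rewrite /B gen_cst add0r. Qed.

Lemma ler_shifted_gen f g :
  (forall x, f x <= g x) -> forall x, B f x <= B g x.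
Proof.
move=> fg x; rewrite !shifted_genE lerD//.
  by apply: ler_sum => y _; rewrite ler_wpM2l.
by rewrite ler_wpM2l// subr_ge0.
Qed.

Lemma iter_shifted_gen_linear k l f g j :
  iter j B (fun x => k * f x + l * g x) =
  (fun x => k * iter j B f x + l * iter j B g x).
Proof. by elim: j => // j IH; rewrite !iterS IH shifted_gen_linear. Qed.

Lemma iter_shifted_gen_cst k j : iter j B (fun=> k) = (fun=> k * c ^+ j).
Proof.
elim: j => [|j IH]; first by apply/funext => x; rewrite mulr1.
by rewrite iterS IH shifted_gen_cst; apply/funext => x; rewrite exprS mulrCA.
Qed.

Lemma ler_iter_shifted_gen f g j :
  (forall x, f x <= g x) -> forall x, iter j B f x <= iter j B g x.
Proof. by move=> fg; elim: j => // j IH x; exact: ler_shifted_gen. Qed.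

(** By monotonicity $B^j f$ lies between the images of the constants $\pm M$, which are $\pm M
    c^j$. *)
Lemma geometrically_bounded_iter M f x : bounded_by M f ->
  geometrically_bounded M c (fun j => iter j B f x).
Proof.
move=> fM j; rewrite ler_norml; apply/andP; split.
  rewrite -mulNr -[leLHS]/((fun=> - M * c ^+ j) x) -iter_shifted_gen_cst.
  apply: ler_iter_shifted_gen => y.
  by have := fM y; rewrite ler_norml => /andP[].
rewrite -[leRHS]/((fun=> M * c ^+ j) x) -iter_shifted_gen_cst.
by apply: ler_iter_shifted_gen => y; have /ler_normlP[] := fM y.
Qed.

Lemma bounded_gen M f : bounded_by M f -> bounded_by (2 * c * M) (gen f).
Proof.
move=> fM x; have M0 := bounded_by_ge0 x fM.
apply: le_trans (ler_norm_sum _ _ _) _.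
apply: (@le_trans _ _ (\sum_(y <- N x) a x y * (2 * M))).
  apply: ler_sum => y _; rewrite normrM (ger0_norm (a_ge0 x y)) ler_wpM2l//.
  by rewrite (le_trans (ler_normB _ _))// mulr_natl mulr2n lerD.
rewrite -mulr_suml [2 * c]mulrC -mulrA.
by rewrite ler_wpM2r// mulr_ge0.
Qed.

Lemma bounded_linear M M' k l f g : bounded_by M f -> bounded_by M' g ->
  bounded_by (`|k| * M + `|l| * M') (fun x => k * f x + l * g x).
Proof.
move=> fM gM x; rewrite (le_trans (ler_normD _ _))// !normrM lerD//.
  by rewrite ler_wpM2l.
by rewrite ler_wpM2l.
Qed.

Lemma semigroup_linear M M' k l t f g x : bounded_by M f -> bounded_by M' g ->
  P t (fun x => k * f x + l * g x) x = k * P t f x + l * P t g x.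
Proof.
move=> fM gM; rewrite /P.
under [X in egf X]eq_fun do rewrite iter_shifted_gen_linear.
rewrite (egf_linear _ _ _ c_ge0
  (geometrically_bounded_iter x fM) (geometrically_bounded_iter x gM)); ring.
Qed.

Lemma semigroup_cst k t x : P t (fun=> k) x = k.
Proof.
rewrite /P; under [X in egf X]eq_fun do rewrite iter_shifted_gen_cst.
by rewrite egf_geomM mulrCA -expRD addNr expR0 mulr1.
Qed.

Lemma ler_semigroup M M' t f g x : 0 <= t ->
  bounded_by M f -> bounded_by M' g -> (forall y, f y <= g y) ->
  P t f x <= P t g x.
Proof.
move=> t0 fM gM fg; rewrite /P ler_wpM2l ?expR_ge0//.
apply: (ler_egf c_ge0 t0 (geometrically_bounded_iter x fM)
  (geometrically_bounded_iter x gM)) => j.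
exact: ler_iter_shifted_gen.
Qed.

Lemma bounded_semigroup M t f : 0 <= t -> bounded_by M f -> bounded_by M (P t f).
Proof.
move=> t0 fM x; rewrite /P normrM (ger0_norm (expR_ge0 _)).
rewrite (@le_trans _ _ (expR (- (c * t)) * (M * expR (c * t))))//.
  rewrite ler_wpM2l ?expR_ge0//.
  exact: normr_egf c_ge0 t0 (geometrically_bounded_iter x fM).
by rewrite mulrCA -expRD addNr expR0 mulr1.
Qed.

Lemma semigroup0 M f x : bounded_by M f -> P 0 f x = f x.
Proof.
move=> fM; rewrite /P mulr0 oppr0 expR0 mul1r.
have := normr_egf_tail 1 c_ge0 (lexx 0)
  (geometrically_bounded_iter x fM).
rewrite /exp_tail /pseries /series /= !big_nat1 /= mulr0 expR0 !expr0.
by rewrite invr1 !mulr1 subrr mulr0 normr_le0 subr_eq0 => /eqP.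
Qed.

(** The shifted series splits by $B^{j+1} f = B^j(Lf) + c B^j f$, and its second part cancels the
    derivative of $e^{-ct}$ in the product rule. *)
Lemma is_derive_semigroup M t f x : bounded_by M f ->
  is_derive t 1 (fun s => P s f x) (P t (gen f) x).
Proof.
move=> fM; rewrite /P.
have fB := geometrically_bounded_iter x fM.
have LB := geometrically_bounded_iter x (bounded_gen fM).
have D1 := @is_derive_egf _ _ _ _ t c_ge0 fB.
have D2 : is_derive t 1 (fun s => expR (- (c * s))) (- c * expR (- (c * t))).
  have d : is_derive t 1 (fun s : R => - (c * s)) (- c).
    by apply: is_derive_eq; rewrite -[_ *: _]/(_ * _) mulr1.
  have := is_derive1_comp (is_derive_expR _) d.
  by move=> /is_derive_eq; apply; rewrite mulrC.
have D := is_deriveM D2 D1; apply: (is_derive_eq D).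
rewrite -![_ *: _]/(_ * _).
have -> : (fun j => iter j.+1 B f x) =
    (fun j => 1 * iter j B (gen f) x + c * iter j B f x).
  apply/funext => j; rewrite iterSr.
  have -> : B f = (fun y => 1 * gen f y + c * f y).
    by apply/funext => y; rewrite /B mul1r.
  by rewrite iter_shifted_gen_linear.
rewrite (egf_linear _ _ _ c_ge0 LB fB); ring.
Qed.

Lemma semigroup_mean_value M t t' f x : bounded_by M f -> t <= t' ->
  exists2 s, t <= s <= t' & P t' f x - P t f x = P s (gen f) x * (t' - t).
Proof.
move=> fM tt'.
have der (s : R) : is_derive s 1 (fun s => P s f x) (P s (gen f) x).
  exact: is_derive_semigroup fM.
have [|s sI ->] := MVT_segment tt' (fun s _ => der s).
  apply: derivable_within_continuous => s _; exact: ex_derive.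
by exists s => //; rewrite in_itv in sI.
Qed.

(** * Approximation of the semigroup by Euler steps *)

Lemma semigroup_euler_step M t h f x : 0 <= t -> 0 <= h -> bounded_by M f ->
  `|P (t + h) f x - P t (Q h f) x| <= (2 * c) ^+ 2 * M * h ^+ 2.
Proof.
move=> t0 h0 fM; have LM := bounded_gen fM; have LLM := bounded_gen LM.
have Qlin : Q h f = (fun x => 1 * f x + h * gen f x).
  by apply/funext => y; rewrite mul1r.
rewrite Qlin (semigroup_linear _ _ _ _ fM LM) mul1r opprD addrA.
(* The mean value theorem is used twice: $P_{t+h}f - P_tf = h P_s Lf$, then $P_s Lf - P_t Lf = (s-t)
   P_r L^2 f$, where $|L^2 f| \le (2c)^2 M$. *)
have [|s /andP[ts sth] ->] := @semigroup_mean_value _ t (t + h) _ x fM.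
  by rewrite lerDl.
have [//|r /andP[tr rs] E] := @semigroup_mean_value _ t s _ x LM.
have r0 : 0 <= r by exact: le_trans tr.
rewrite (_ : _ - _ = P r (gen (gen f)) x * ((s - t) * h)); last first.
  by rewrite mulrA -E; ring.
rewrite (_ : _ * h ^+ 2 = (2 * c * (2 * c * M)) * (h * h)); last by ring.
rewrite normrM; apply: ler_pM => //; first exact: bounded_semigroup.
rewrite normrM (ger0_norm h0) ler_wpM2r//.
by rewrite ger0_norm ?subr_ge0// lerBlDl.
Qed.

(** For $h \ge 0$ and $hc \le 1$ both coefficients are nonnegative, so an Euler step is monotone. *)
Lemma euler_stepE h f x :
  Q h f x = (1 - h * c) * f x + h * B f x.
Proof. by rewrite /Q /B; ring. Qed.

Lemma euler_step_cst h k : Q h (fun=> k) = (fun=> k).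
Proof. by apply/funext => x; rewrite /Q gen_cst mulr0 addr0. Qed.

Lemma euler_step_linear h k l f g :
  Q h (fun x => k * f x + l * g x) = (fun x => k * Q h f x + l * Q h g x).
Proof. by apply/funext => x; rewrite /Q gen_linear; ring. Qed.

Lemma ler_euler_step h f g : 0 <= h -> h * c <= 1 ->
  (forall x, f x <= g x) -> forall x, Q h f x <= Q h g x.
Proof.
move=> h0 hc fg x; rewrite !euler_stepE lerD//.
  by rewrite ler_wpM2l// subr_ge0.
by rewrite ler_wpM2l// ler_shifted_gen.
Qed.

Lemma bounded_euler_step M h f : 0 <= h -> h * c <= 1 ->
  bounded_by M f -> bounded_by M (Q h f).
Proof.
move=> h0 hc fM x; rewrite ler_norml; apply/andP; split.
  rewrite -[leLHS]/((fun=> - M) x) -(euler_step_cst h).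
  by apply: ler_euler_step => // y; have := fM y; rewrite ler_norml => /andP[].
rewrite -[leRHS]/((fun=> M) x) -(euler_step_cst h).
by apply: ler_euler_step => // y; have := fM y; rewrite ler_norml => /andP[].
Qed.

Lemma bounded_iter_euler_step M h f n : 0 <= h -> h * c <= 1 ->
  bounded_by M f -> bounded_by M (iter n (Q h) f).
Proof.
by move=> h0 hc fM; elim: n => // n IH; rewrite iterS; exact: bounded_euler_step.
Qed.

(** Telescoping: the last time interval of length [h] is traded for an Euler step applied to [f],
    and the errors add up because [Q] preserves the bound [M]. *)
Lemma semigroup_iter_euler_step M t h n f x : 0 <= t -> 0 <= h -> h * c <= 1 ->
  bounded_by M f ->
  `|P (t + n%:R * h) f x - P t (iter n (Q h) f) x|
    <= n%:R * ((2 * c) ^+ 2 * M * h ^+ 2).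
Proof.
move=> t0 h0 hc; elim: n f => [|n IH] f fM.
  by rewrite mul0r addr0 subrr normr0 mul0r.
have -> : t + n.+1%:R * h = (t + n%:R * h) + h by rewrite -natr1; ring.
rewrite iterSr -natr1 mulrDl mul1r.
have QM := bounded_euler_step h0 hc fM.
have th0 : 0 <= t + n%:R * h by rewrite addr_ge0// mulr_ge0.
rewrite [leRHS]addrC.
apply: le_trans (lerD (semigroup_euler_step x th0 h0 fM) (IH _ QM)).
by apply: le_trans (ler_normD _ _); rewrite addrA subrK.
Qed.

(** With [n.+1] steps of length $t/(n+1)$ the total error is at most $C/(n+1)$; the steps are
    monotone once $n \ge tc$. *)
Lemma cvg_iter_euler_step M t f x : 0 <= t -> bounded_by M f ->
  iter n.+1 (Q (t / n.+1%:R)) f x @[n --> \oo] --> P t f x.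
Proof.
move=> t0 fM; have c0 := c_ge0.
apply/subr_cvg0.
pose C := (2 * c) ^+ 2 * M * t ^+ 2.
apply: norm_cvg0; apply: (@squeeze_cvgr _ _ _ _ (fun=> 0)
    (fun n => C * harmonic n)).
- near=> n; apply/andP; split; first exact: normr_ge0.
  have h0 : 0 <= t / n.+1%:R by rewrite divr_ge0.
  have hc : t / n.+1%:R * c <= 1.
    rewrite mulrAC ler_pdivrMr ?ltr0n// mul1r.
    rewrite (@le_trans _ _ n%:R)// ?ler_nat//.
    by near: n; exact: nbhs_infty_ger.
  have := semigroup_iter_euler_step n.+1 x (lexx 0) h0 hc fM.
  have n1 : n.+1%:R != 0 :> R by rewrite pnatr_eq0.
  rewrite add0r mulrCA divff// mulr1 distrC.
  rewrite (semigroup0 x (M := M)); last first.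
    exact: bounded_iter_euler_step.
  move=> /le_trans; apply; rewrite le_eqVlt; apply/orP; left; apply/eqP.
  by rewrite /C /harmonic /=; move: n1; move: n.+1%:R => r r0; field.
- exact: cvg_cst.
- by rewrite -[X in _ --> X](mulr0 C); apply: cvgMr; exact: cvg_harmonic.
Unshelve. all: end_near. Qed.

(** * Finite propagation *)

Definition hull (s : seq V) := s ++ flatten (map N s).

Lemma sub_hull s : {subset s <= hull s}.
Proof. by move=> x xs; rewrite mem_cat xs. Qed.

Lemma iter_hull_le s m n : (m <= n)%N -> {subset iter m hull s <= iter n hull s}.
Proof.
move=> mn x xm; rewrite -(subnK mn) iterD.
by elim: (n - m)%N => // k IH; rewrite iterS sub_hull.
Qed.

Lemma nbr_hull s x y : x \in s -> y \in N x -> y \in hull s.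
Proof.
move=> xs yx; rewrite mem_cat; apply/orP; right.
by apply/flatten_mapP; exists x.
Qed.

Lemma eq_in_gen s f g : {in hull s, f =1 g} -> {in s, gen f =1 gen g}.
Proof.
move=> fg x xs; rewrite /gen; apply: eq_big_seq => y yx.
by rewrite !fg//; [exact: sub_hull | exact: nbr_hull yx].
Qed.

Lemma eq_in_carre_du_champ s f f' g g' :
  {in hull s, f =1 f'} -> {in hull s, g =1 g'} ->
  {in s, carre_du_champ f g =1 carre_du_champ f' g'}.
Proof.
move=> ff gg x xs; rewrite /carre_du_champ; congr (_ * _).
apply: eq_big_seq => y yx; have xh := sub_hull xs; have yh := nbr_hull xs yx.
by rewrite !ff// !gg.
Qed.

(** Each application of $B$ looks one step further; [iter j hull s] lists the vertices reachable
    from [s] in at most [j] steps. *)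
Lemma eq_in_iter_shifted_gen s f g j : {in iter j hull s, f =1 g} ->
  {in s, iter j B f =1 iter j B g}.
Proof.
elim: j s => [//|j IH] s fg x xs; rewrite !iterS {1 3}/B.
have e : {in hull s, iter j B f =1 iter j B g} by apply: IH; rewrite -iterSr.
by rewrite (eq_in_gen e)// e// sub_hull.
Qed.

(** * The carre du champ and its expansion at square roots *)

Local Notation "'\Gamma' f" := (carre_du_champ f f) (at level 10, f at level 8).

Lemma carre_du_champ_linear k l f g u x :
  carre_du_champ f (fun y => k * g y + l * u y) x
    = k * carre_du_champ f g x + l * carre_du_champ f u x.
Proof.
rewrite /carre_du_champ !mulr_sumr -big_split /=.
by apply: eq_bigr => y _; ring.
Qed.

Lemma carre_du_champD f g x :
  \Gamma (fun y => f y + g y) x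
    = \Gamma f x + 2 * carre_du_champ f g x + \Gamma g x.
Proof.
rewrite /carre_du_champ !mulr_sumr -!big_split /=.
by apply: eq_bigr => y _; ring.
Qed.

Lemma carre_du_champ_ge0 f x : 0 <= \Gamma f x.
Proof.
rewrite mulr_ge0 ?invr_ge0//; apply: sumr_ge0 => y _.
by rewrite mulr_ge0// -expr2 sqr_ge0.
Qed.

Lemma bounded_carre_du_champ M M' f g : bounded_by M f -> bounded_by M' g ->
  bounded_by (2 * c * M * M') (carre_du_champ f g).
Proof.
move=> fM gM x; have M0 := bounded_by_ge0 x fM; have M'0 := bounded_by_ge0 x gM.
rewrite normrM ger0_norm ?invr_ge0//.
have -> : 2 * c * M * M' = 2^-1 * (c * ((M + M) * (M' + M'))) by field.
rewrite ler_wpM2l ?invr_ge0//.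
apply: le_trans (ler_norm_sum _ _ _) _.
apply: (@le_trans _ _ (\sum_(y <- N x) a x y * ((M + M) * (M' + M')))).
  apply: ler_sum => y _; rewrite normrM (ger0_norm (a_ge0 x y)) ler_wpM2l//.
  rewrite normrM ler_pM// (le_trans (ler_normB _ _))// lerD//.
by rewrite -mulr_suml ler_wpM2r// mulr_ge0// addr_ge0.
Qed.

(** With $q = \sqrt{u+d}$ and $g = \sqrt u$, both claims come from $d = (q-g)(q+g) = 2g(q-g) +
    (q-g)^2$; the lower bound [e] keeps denominators away from 0. *)
Lemma sqrt_taylor (e u d : R) : 0 < e -> e <= u -> 0 <= u + d ->
  [/\ Num.sqrt (u + d) - Num.sqrt u
        = d / (2 * Num.sqrt u)
          - (Num.sqrt (u + d) - Num.sqrt u) ^+ 2 / (2 * Num.sqrt u)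
    & `|Num.sqrt (u + d) - Num.sqrt u| <= `|d| / Num.sqrt e].
Proof.
move=> e0 eu ud0; have u0 : 0 < u by exact: lt_le_trans eu.
have se0 : 0 < Num.sqrt e by rewrite sqrtr_gt0.
have su0 : 0 < Num.sqrt u by rewrite sqrtr_gt0.
have seu : Num.sqrt e <= Num.sqrt u by rewrite ler_sqrt// ltW.
have q0 := sqrtr_ge0 (u + d).
have Eq := sqr_sqrtr ud0; have Eg := sqr_sqrtr (ltW u0).
move: (Num.sqrt (u + d)) (Num.sqrt u) (Num.sqrt e) se0 su0 seu q0 Eq Eg
  => q g r r0 g0 rg q0 Eq Eg.
have Ed : d = (q - g) * (q + g) by rewrite -subr_sqr Eq Eg; ring.
split; first by rewrite Ed; field; rewrite lt0r_neq0.
have qg0 : 0 <= q + g by rewrite addr_ge0// ltW.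
rewrite ler_pdivlMr// Ed normrM (ger0_norm qg0) ler_wpM2l//.
by rewrite (le_trans rg)// lerDr.
Qed.

(* Half the derivative of \Gamma (sqrt u) along the flow u' = gen u. *)
Definition drift u x := carre_du_champ (fun y => Num.sqrt (u y))
  (fun y => gen u y / (2 * Num.sqrt (u y))) x.

Definition carre_sqrt u := \Gamma (fun y => Num.sqrt (u y)).

(** Write $\sqrt v = g + d$ with $g = \sqrt u$ and $d = h\,Lu/(2g) + r$, where $r = O(h^2)$. In
    $\Gamma(g+d) = \Gamma(g) + 2\Gamma(g,d) + \Gamma(d)$ the linear part is $2h$ times the drift,
    and the error is $2\Gamma(g,r) + \Gamma(d)$. The slack $Dh^2$ allows [v] to be an Euler step or
    a value of the semigroup. *)
Lemma carre_sqrt_taylor (e M D : R) : 0 < e -> 0 <= M -> 0 <= D ->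
  exists2 C : R, 0 <= C & forall u v h x, 0 <= h <= 1 ->
    (forall y, e <= u y) -> bounded_by M u -> (forall y, 0 <= v y) ->
    (forall y, `|v y - (u y + h * gen u y)| <= D * h ^+ 2) ->
    `|carre_sqrt v x - (carre_sqrt u x + 2 * h * drift u x)| <= C * h ^+ 2.
Proof.
move=> e0 M0 D0.
have se0 : 0 < Num.sqrt e by rewrite sqrtr_gt0.
have Ese := sqr_sqrtr (ltW e0).
have sM0 := sqrtr_ge0 M.
(* For $h \le 1$, $K_1 h$ will bound $|v-u|$, $(K_1/\sqrt e)h$ will bound $|d|$ and $K_2 h^2$ will
   bound $|r|$. *)
pose K1 := 2 * c * M + D; pose se := Num.sqrt e.
pose K2 := (D + (K1 / se) ^+ 2) / (2 * se).
have K10 : 0 <= K1 by rewrite addr_ge0// !mulr_ge0.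
have K1s0 : 0 <= K1 / se by rewrite divr_ge0// ltW.
have K20 : 0 <= K2 by rewrite divr_ge0 ?mulr_ge0 ?addr_ge0 ?sqr_ge0// ltW.
exists (2 * (2 * c * Num.sqrt M * K2) + 2 * c * (K1 / se) * (K1 / se)).
  have c20 : 0 <= 2 * c by rewrite mulr_ge0.
  apply: addr_ge0; last by apply: mulr_ge0 => //; exact: mulr_ge0.
  by apply: mulr_ge0 => //; apply: mulr_ge0 => //; exact: mulr_ge0.
move=> u v h x /andP[h0 h1] eu uM v0 vu.
pose g y := Num.sqrt (u y); pose d y := Num.sqrt (v y) - Num.sqrt (u y).
pose r y := d y - h * (gen u y / (2 * Num.sqrt (u y))).
have gM : bounded_by (Num.sqrt M) g.
  move=> y; rewrite ger0_norm ?sqrtr_ge0// ler_sqrt//.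
  by rewrite (le_trans (ler_norm _)).
have taylor y : [/\ d y = (v y - u y) / (2 * Num.sqrt (u y))
        - d y ^+ 2 / (2 * Num.sqrt (u y)) & `|d y| <= `|v y - u y| / se].
  have : 0 <= u y + (v y - u y) by rewrite addrC subrK.
  by move=> /(sqrt_taylor e0 (eu y)); rewrite [u y + _]addrC subrK.
have vuK y : `|v y - u y| <= K1 * h.
  rewrite (_ : v y - u y = v y - (u y + h * gen u y) + h * gen u y); last by ring.
  rewrite (le_trans (ler_normD _ _))// /K1 mulrDl addrC lerD//.
    by rewrite normrM (ger0_norm h0) mulrC ler_wpM2r// bounded_gen.
  by rewrite (le_trans (vu y))// expr2 ler_wpM2l// ler_piMr.
have dK : bounded_by (K1 / se * h) d.
  move=> y; have [_ /le_trans->//] := taylor y.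
  by rewrite mulrAC ler_wpM2r ?invr_ge0 ?(ltW se0).
have rK : bounded_by (K2 * h ^+ 2) r.
  move=> y; have su0 : 0 < Num.sqrt (u y) by rewrite sqrtr_gt0 (lt_le_trans e0).
  have -> : r y = ((v y - (u y + h * gen u y)) - d y ^+ 2) / (2 * Num.sqrt (u y)).
    have [E _] := taylor y; rewrite /r {1}E; field.
    by rewrite lt0r_neq0.
  have su2 : 0 <= 2 * Num.sqrt (u y) by rewrite mulr_ge0// ltW.
  rewrite normrM normfV (ger0_norm su2).
  rewrite (_ : K2 * _ = (D * h ^+ 2 + (K1 / se * h) ^+ 2) / (2 * se)); last first.
    by rewrite /K2; ring.
  have i0 : 0 <= (2 * Num.sqrt (u y))^-1 by rewrite invr_ge0 mulr_ge0// ltW.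
  apply: ler_pM => //.
    rewrite (le_trans (ler_normB _ _))// lerD// normrX ler_sqr ?nnegrE//.
    by rewrite mulr_ge0.
  rewrite lef_pV2 ?posrE ?mulr_gt0// ler_wpM2l// ler_sqrt//.
  by rewrite ltW// (lt_le_trans e0).
have Ev : (fun y => Num.sqrt (v y)) = (fun y => g y + d y).
  by apply/funext => y; rewrite /g /d addrC subrK.
have Ed : d = (fun y => 1 * r y + h * (gen u y / (2 * Num.sqrt (u y)))).
  by apply/funext => y; rewrite /r mul1r subrK.
have -> : carre_sqrt v x - (carre_sqrt u x + 2 * h * drift u x)
    = 2 * carre_du_champ g r x + \Gamma d x.
  rewrite /carre_sqrt Ev carre_du_champD {1}Ed carre_du_champ_linear.
  by rewrite /drift -/g; ring.
rewrite (le_trans (ler_normD _ _))// [leRHS]mulrDl lerD//.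
  rewrite normrM ger0_norm// -mulrA ler_wpM2l//.
  by rewrite (le_trans (bounded_carre_du_champ gM rK x))// mulrA.
rewrite (le_trans (bounded_carre_du_champ dK dK x))//.
by rewrite le_eqVlt; apply/orP; left; apply/eqP; ring.
Qed.

Lemma bounded_sqrt M u : bounded_by M u ->
  bounded_by (Num.sqrt M) (fun y => Num.sqrt (u y)).
Proof.
move=> uM y; have M0 := bounded_by_ge0 y uM.
by rewrite ger0_norm ?sqrtr_ge0// ler_sqrt// (le_trans (ler_norm _)).
Qed.

Lemma bounded_carre_sqrt M u : 0 <= M -> bounded_by M u ->
  bounded_by (2 * c * M) (carre_sqrt u).
Proof.
move=> M0 uM x; have sM := bounded_sqrt uM.
have := bounded_carre_du_champ sM sM x.
by rewrite -[_ * _ * Num.sqrt M]mulrA -expr2 sqr_sqrtr.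
Qed.

(** * From curvature to the gradient estimate *)

Definition curvature_ge K := forall f, (forall x, 0 < f x) -> forall x,
  - K * \Gamma f x <= 2^-1 * gen (\Gamma f) x
    - carre_du_champ f (fun y => gen (fun z => f z ^+ 2) y / (2 * f y)) x.

Lemma le_euler_step_iter (e h : R) n u : 0 <= h -> h * c <= 1 ->
  (forall y, e <= u y) -> forall y, e <= iter n (Q h) u y.
Proof.
move=> h0 hc eu; elim: n => // n IH y; rewrite iterS.
rewrite -[leLHS]/((fun=> e) y) -(euler_step_cst h).
exact: ler_euler_step.
Qed.

(** With $G = \Gamma(\sqrt u)$, curvature bounds twice the drift by $LG + 2KG$. So
    $\Gamma(\sqrt{Qu})$ is at most $(1+2Kh)\,QG - 2Kh^2 LG$ plus the Taylor error, and $1+2Kh \le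
    e^{2Kh}$ while $QG \ge 0$. *)
Lemma carre_sqrt_euler_step (e M K : R) : 0 < e -> 0 <= M -> curvature_ge K ->
  exists2 C : R, 0 <= C & forall u h x, 0 <= h <= 1 -> h * c <= 1 ->
    (forall y, e <= u y) -> bounded_by M u ->
    carre_sqrt (Q h u) x
      <= expR (2 * K * h) * Q h (carre_sqrt u) x + C * h ^+ 2.
Proof.
move=> e0 M0 cK.
have [C1 C10 H] := carre_sqrt_taylor e0 M0 (lexx 0).
have E0 : 0 <= `|2 * K| * (2 * c * (2 * c * M)).
  by rewrite mulr_ge0// !mulr_ge0.
(* The second term bounds $|2K\,LG|$, from $0 \le G \le 2cM$. *)
exists (C1 + `|2 * K| * (2 * c * (2 * c * M))); first exact: addr_ge0.
move=> u h x /andP[h0 h1] hc eu uM.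
have u0 y : 0 < u y by exact: lt_le_trans (eu y).
have Qe y : e <= Q h u y := @le_euler_step_iter e h 1 u h0 hc eu y.
have := H u (Q h u) h x; rewrite h0 h1 => /(_ isT eu uM).
have v0 y : 0 <= Q h u y by rewrite (le_trans (ltW e0)).
move=> /(_ v0) {}H.
have {H}/ler_normlP[_] :
    `|carre_sqrt (Q h u) x - (carre_sqrt u x + 2 * h * drift u x)| <= C1 * h ^+ 2.
  by apply: H => y; rewrite /Q subrr normr0 mul0r.
have := cK (fun y => Num.sqrt (u y)).
have su0 y : 0 < Num.sqrt (u y) by rewrite sqrtr_gt0.
move=> /(_ su0 x); rewrite -/(carre_sqrt u).
rewrite (_ : (fun z => _ ^+ 2) = u); last first.
  by apply/funext => z; rewrite sqr_sqrtr// ltW.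
rewrite -/(drift u x) => curv taylor.
have G0 : 0 <= carre_sqrt u x by exact: carre_du_champ_ge0.
have QG0 : 0 <= Q h (carre_sqrt u) x.
  by apply: (@le_euler_step_iter 0 h 1) => // y; exact: carre_du_champ_ge0.
have eK := expR_ge1Dx (2 * K * h).
have := ler_wpM2r QG0 eK.
move: (bounded_gen (bounded_carre_sqrt M0 uM) x) => gG.
have : - (2 * K * gen (carre_sqrt u) x) <= `|2 * K| * (2 * c * (2 * c * M)).
  rewrite (le_trans (ler_norm _))// normrN normrM ler_wpM2l//.
move=> /(ler_wpM2l (sqr_ge0 h)).
have := ler_wpM2l h0 curv.
rewrite /Q; move: (expR _) (carre_sqrt (Q h u) x) (carre_sqrt u x) (gen _ x)
  (drift u x) taylor; move=> *; nra.
Qed.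

(** Since [Q] is monotone and fixes constants, a further step multiplies the previous error by
    $e^{2Kh}$ and adds $Ch^2$. The absolute value of $2K$ keeps the exponential factor at least 1,
    so that it also absorbs the new $Ch^2$. *)
Lemma carre_sqrt_iter_euler_step (e M K : R) : 0 < e -> 0 <= M ->
  curvature_ge K ->
  exists2 C : R, 0 <= C & forall u h n x, 0 <= h <= 1 -> h * c <= 1 ->
    (forall y, e <= u y) -> bounded_by M u ->
    carre_sqrt (iter n (Q h) u) x
      <= expR (2 * K * (n%:R * h)) * iter n (Q h) (carre_sqrt u) x
         + C * n%:R * h ^+ 2 * expR (`|2 * K| * (n%:R * h)).
Proof.
move=> e0 M0 cK; have [C C0 step] := carre_sqrt_euler_step e0 M0 cK.
exists C => // u h n x hI hc eu uM; have h0 : 0 <= h by case/andP: hI.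
elim: n x => [|n IH] x.
  by rewrite mul0r !mulr0 expR0 mul1r !mul0r addr0.
have Qe := le_euler_step_iter n h0 hc eu.
have QM := bounded_iter_euler_step n h0 hc uM.
rewrite !iterS; apply: le_trans (step _ _ x hI hc Qe QM) _.
have /(_ x) := ler_euler_step h0 hc IH.
rewrite (_ : (fun=> _) = (fun y => expR (2 * K * (n%:R * h))
    * iter n (Q h) (carre_sqrt u) y
  + (C * n%:R * h ^+ 2 * expR (`|2 * K| * (n%:R * h))) * (fun=> 1) y)); last first.
  by apply/funext => y; rewrite mulr1.
rewrite euler_step_linear euler_step_cst mulr1.
move=> /(ler_wpM2l (expR_ge0 (2 * K * h))) H.
rewrite (le_trans (lerD H (lexx _)))//.
rewrite (mulrDr (expR (2 * K * h))) mulrA -expRD.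
have -> : 2 * K * h + 2 * K * (n%:R * h) = 2 * K * (n.+1%:R * h).
  by rewrite -natr1; ring.
rewrite -addrA lerD2l.
have -> : `|2 * K| * (n.+1%:R * h) = `|2 * K| * h + `|2 * K| * (n%:R * h).
  by rewrite -natr1; ring.
rewrite expRD.
set E := expR (`|2 * K| * (n%:R * h)).
have E1 : 1 <= E by rewrite -expR0 ler_expR mulr_ge0// mulr_ge0.
have F1 : 1 <= expR (`|2 * K| * h) by rewrite -expR0 ler_expR mulr_ge0.
have F2 : expR (2 * K * h) <= expR (`|2 * K| * h).
  by rewrite ler_expR ler_wpM2r// ler_norm.
have Ch : 0 <= C * h ^+ 2 by rewrite mulr_ge0// sqr_ge0.
have FE1 : 1 <= expR (`|2 * K| * h) * E.
  by rewrite (le_trans E1)// ler_peMl// (le_trans ler01).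
rewrite [leRHS](_ : _ = expR (`|2 * K| * h) * (C * n%:R * h ^+ 2 * E)
   + C * h ^+ 2 * (expR (`|2 * K| * h) * E)); last by rewrite -natr1; ring.
apply: lerD; last by rewrite ler_peMr.
apply: ler_wpM2r => //; apply: mulr_ge0; last exact: expR_ge0.
by rewrite mulrAC mulr_ge0.
Qed.

Lemma cvg_carre_sqrt (u_ : nat -> V -> R) u x :
  (forall y, u_ n y @[n --> \oo] --> u y) ->
  carre_sqrt (u_ n) x @[n --> \oo] --> carre_sqrt u x.
Proof.
move=> uu; apply: cvgMr; apply: cvg_big => [|y _]; first exact: add_continuous.
have sq z : Num.sqrt (u_ n z) @[n --> \oo] --> Num.sqrt (u z).
  exact: continuous_cvg (@sqrt_continuous _ _) (uu z).
by apply: cvgMr; apply: cvgM; apply: cvgB.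
Qed.

(** With $h = t/(n+1)$ the accumulated error is $Ct^2 e^{|2K|t}/(n+1)$, which tends to 0;
    [harmonic n] is $1/(n+1)$. *)
Lemma carre_sqrt_semigroup_of_lbound (e M K t : R) f x : 0 < e -> 0 <= M ->
  curvature_ge K -> 0 <= t -> (forall y, e <= f y) -> bounded_by M f ->
  carre_sqrt (P t f) x <= expR (2 * K * t) * P t (carre_sqrt f) x.
Proof.
move=> e0 M0 cK t0 ef fM.
have [C C0 step] := carre_sqrt_iter_euler_step e0 M0 cK.
have cl := cvg_carre_sqrt (x := x) (fun y => cvg_iter_euler_step (x := y) t0 fM).
have cr := cvg_iter_euler_step (x := x) t0 (bounded_carre_sqrt M0 fM).
have cr2 : expR (2 * K * t) * iter n.+1 (Q (t / n.+1%:R)) (carre_sqrt f) x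
   + C * t ^+ 2 * expR (`|2 * K| * t) * harmonic n @[n --> \oo] -->
   expR (2 * K * t) * P t (carre_sqrt f) x.
  rewrite -[X in _ --> X]addr0.
  rewrite -[X in _ --> _ + X](mulr0 (C * t ^+ 2 * expR (`|2 * K| * t))).
  apply: cvgD; first exact: cvgMr.
  by apply: cvgMr; exact: cvg_harmonic.
rewrite -(cvg_lim _ cl)// -(cvg_lim _ cr2)//; apply: ler_lim.
- by apply/cvg_ex; eexists; exact: cl.
- by apply/cvg_ex; eexists; exact: cr2.
near=> n.
have n1 : n.+1%:R != 0 :> R by rewrite pnatr_eq0.
have h0 : 0 <= t / n.+1%:R by rewrite divr_ge0.
have hc : t / n.+1%:R * c <= 1.
  rewrite mulrAC ler_pdivrMr ?ltr0n// mul1r.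
  rewrite (@le_trans _ _ n%:R)// ?ler_nat//.
  by near: n; exact: nbhs_infty_ger.
have h1 : t / n.+1%:R <= 1.
  rewrite ler_pdivrMr ?ltr0n// mul1r (@le_trans _ _ n%:R)// ?ler_nat//.
  by near: n; exact: nbhs_infty_ger.
have := step f (t / n.+1%:R) n.+1 x; rewrite h0 h1 => /(_ isT hc ef fM).
move=> /le_trans; apply.
have -> : n.+1%:R * (t / n.+1%:R) = t by rewrite mulrCA divff// mulr1.
rewrite lerD2l le_eqVlt; apply/orP; left; apply/eqP.
by rewrite /harmonic /=; move: n1; move: n.+1%:R => r r0; field.
Unshelve. all: end_near. Qed.

(** The difference of the square roots times their sum is $f(y) - f(x)$ whatever [e], and the sum
    grows with [e]. *)
Lemma carre_sqrt_addr_le (e : R) f x : 0 <= e -> (forall y, 0 <= f y) ->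
  carre_sqrt (fun y => f y + e) x <= carre_sqrt f x.
Proof.
move=> e0 f0; rewrite /carre_sqrt /carre_du_champ ler_wpM2l ?invr_ge0//.
apply: ler_sum => y _; rewrite ler_wpM2l// -!expr2.
have fe0 z : 0 <= f z + e by rewrite addr_ge0.
have lb z : Num.sqrt (f z) <= Num.sqrt (f z + e) by rewrite ler_sqrt// lerDl.
have E : (Num.sqrt (f y + e) - Num.sqrt (f x + e)) *
    (Num.sqrt (f y + e) + Num.sqrt (f x + e))
  = (Num.sqrt (f y) - Num.sqrt (f x)) * (Num.sqrt (f y) + Num.sqrt (f x)).
  by rewrite -!subr_sqr !sqr_sqrtr//; ring.
move: (lb x) (lb y) (sqrtr_ge0 (f x)) (sqrtr_ge0 (f y)) E.
move: (Num.sqrt (f y + e)) (Num.sqrt (f x + e)) (Num.sqrt (f y)) (Num.sqrt (f x)).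
move=> p q r s sq rp s0 r0 E.
(* The sum [p + q] may vanish, and then all four roots are 0. *)
have [pq0|pq0] := ltP 0 (p + q); last first.
  by have [-> -> -> ->] : [/\ p = 0, q = 0, r = 0 & s = 0] by split; lra.
rewrite -(ler_pM2r (exprn_gt0 2 pq0)) -exprMn E exprMn ler_wpM2l ?sqr_ge0//.
have rs0 : 0 <= r + s by exact: addr_ge0.
by rewrite ler_sqr ?nnegrE ?(ltW pq0)// lerD.
Qed.

(** Adding $1/(n+1)$ to [f] supplies a positive lower bound. As the shift tends to 0 the left side
    converges, while the right side never exceeds its value at [f]. *)
Theorem carre_sqrt_semigroup (M K t : R) f x : curvature_ge K ->
  0 <= t -> (forall y, 0 < f y) -> bounded_by M f ->
  carre_sqrt (P t f) x <= expR (2 * K * t) * P t (carre_sqrt f) x.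
Proof.
move=> cK t0 f0 fM; have M0 := bounded_by_ge0 x fM.
have f_ge0 y : 0 <= f y by exact: ltW.
pose u n y := P t f y + harmonic n.
have cu y : u n y @[n --> \oo] --> P t f y.
  rewrite -[X in _ --> X]addr0; apply: cvgD; first exact: cvg_cst.
  exact: cvg_harmonic.
rewrite -(cvg_lim _ (cvg_carre_sqrt (x:=x) cu))//; apply: limr_le.
  by apply/cvg_ex; eexists; exact: (cvg_carre_sqrt (x := x) cu).
apply: nearW => n.
have e0 : 0 < harmonic n :> R by rewrite invr_gt0.
pose fn y := f y + harmonic n.
have fnM : bounded_by (M + harmonic n) fn.
  by move=> y; rewrite (le_trans (ler_normD _ _))// lerD// ger0_norm// ltW.
have fnE : fn = (fun y => 1 * f y + harmonic n * (fun=> 1) y).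
  by apply/funext => y; rewrite mul1r mulr1.
have b1 : bounded_by 1 (fun=> 1 : R) by move=> y; rewrite normr1.
have -> : u n = P t fn.
  apply/funext => y; rewrite fnE (semigroup_linear _ _ _ _ fM b1).
  by rewrite semigroup_cst mul1r mulr1.
have Mn0 : 0 <= M + harmonic n by rewrite addr_ge0// ltW.
have := carre_sqrt_semigroup_of_lbound x e0 Mn0 cK t0 _ fnM.
move=> /(_ _)/le_trans; apply; first by move=> y; rewrite lerDr.
rewrite ler_wpM2l ?expR_ge0//.
apply: ler_semigroup (bounded_carre_sqrt Mn0 fnM) (bounded_carre_sqrt M0 fM) _ => //.
by move=> y; apply: carre_sqrt_addr_le => //; exact: ltW.
Qed.

(** * From the gradient estimate back to curvature *)

Lemma semigroup_taylor M h f x : 0 <= h -> bounded_by M f ->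
  `|P h f x - (f x + h * gen f x)| <= (2 * c) ^+ 2 * M * h ^+ 2.
Proof.
move=> h0 fM; have := semigroup_euler_step x (lexx 0) h0 fM; rewrite add0r.
have QM := bounded_linear 1 h fM (bounded_gen fM).
have -> : Q h f = (fun y => 1 * f y + h * gen f y).
  by apply/funext => y; rewrite mul1r.
by rewrite (semigroup0 x QM) mul1r.
Qed.

Lemma le0_of_linear_le_quadratic (p q : R) :
  (forall t, 0 < t <= 1 -> t * p <= t ^+ 2 * q) -> p <= 0.
Proof.
move=> H; rewrite leNgt; apply/negP => p0.
(* For this [t], $tq \le p/2$, whereas the hypothesis divided by [t] says $p \le tq$. *)
pose t := Num.min 1 (p / (2 * (`|q| + 1))).
have q1 : 0 < 2 * (`|q| + 1) by rewrite mulr_gt0// ltr_wpDl.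
have t0 : 0 < t by rewrite lt_min ltr01 divr_gt0.
have := H t; rewrite t0 ge_min lexx => /(_ isT).
rewrite expr2 -mulrA (ler_pM2l t0) => ptq.
have : t * (2 * (`|q| + 1)) <= p by rewrite -ler_pdivlMr// ge_min lexx orbT.
have : t * q <= t * `|q| by rewrite ler_pM2l// ler_norm.
lra.
Qed.

(** Both sides of the gradient estimate agree at time 0; comparing their terms of first order in $t$
    gives $2g \le L + 2KG$ in the notation of the proof. *)
Lemma curvature_of_semigroup (e M K : R) f x : 0 < e ->
  (forall y, e <= f y) -> bounded_by M f ->
  (forall t, 0 < t ->
    carre_sqrt (P t f) x <= expR (2 * K * t) * P t (carre_sqrt f) x) ->
  - K * carre_sqrt f x <= 2^-1 * gen (carre_sqrt f) x - drift f x.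
Proof.
move=> e0 ef fM H; have M0 := bounded_by_ge0 x fM.
have D0 : 0 <= (2 * c) ^+ 2 * M by rewrite mulr_ge0// sqr_ge0.
have [C C0 taylor] := carre_sqrt_taylor e0 M0 D0.
set G := carre_sqrt f x; set g := drift f x; set L := gen _ x.
pose E := (2 * c) ^+ 2 * (2 * c * M).
suff : 2 * g - L - 2 * K * G <= 0 by lra.
(* [E] is the error for $P_t\Gamma(\sqrt f)$, [C] that for $\Gamma(\sqrt{P_tf})$, and the last term
   pays for replacing $\Gamma(\sqrt{P_tf})$ by [G] in its product with $2Kt$. *)
apply: (@le0_of_linear_le_quadratic _ (E + C + `|2 * K| * (2 * `|g| + C))).
move=> t /andP[t0 t1]; have t_ge0 := ltW t0.
have fPt y : 0 <= P t f y.
  have b0 : bounded_by 0 (fun=> 0 : R) by move=> z; rewrite normr0.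
  rewrite -[leLHS](semigroup_cst 0 t y); apply: (ler_semigroup _ t_ge0 b0 fM).
  by move=> z; rewrite (le_trans (ltW e0)).
have := taylor f (P t f) t x; rewrite t_ge0 t1.
move=> /(_ isT ef fM fPt (fun y => semigroup_taylor y t_ge0 fM)).
rewrite -/G -/g => /ler_normlP[T1 T2].
have /ler_normlP[_] := semigroup_taylor x t_ge0 (bounded_carre_sqrt M0 fM).
rewrite -/L -/G -/E => S.
have G0 : 0 <= carre_sqrt (P t f) x by exact: carre_du_champ_ge0.
(* The exponential is moved to the left, where $e^{-2Kt} \ge 1 - 2Kt$ bounds it in the useful
   direction. *)
have {}H : (1 - 2 * K * t) * carre_sqrt (P t f) x <= P t (carre_sqrt f) x.
  apply: (@le_trans _ _ (expR (- (2 * K * t)) * carre_sqrt (P t f) x)).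
    by rewrite ler_wpM2r// -[- (2 * K * t)]opprK opprK expR_ge1Dx.
  by rewrite expRN ler_pdivrMl ?expR_gt0// H.
set W := carre_sqrt _ x in T1 T2 H G0.
have K1 : 2 * K * (W - G) <= `|2 * K| * (t * (2 * `|g| + C)).
  rewrite (le_trans (ler_norm _))// normrM ler_wpM2l//.
  have -> : W - G = (W - (G + 2 * t * g)) + 2 * t * g by ring.
  rewrite (le_trans (ler_normD _ _))//.
  have -> : t * (2 * `|g| + C) = t * C + 2 * t * `|g| by ring.
  rewrite lerD//; last by rewrite normrM ger0_norm// mulr_ge0.
  apply: (@le_trans _ _ (C * t ^+ 2)); first by apply/ler_normlP.
  by rewrite expr2 mulrC ler_wpM2r// ler_piMr.
have := ler_wpM2l t_ge0 K1.
nra.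
Qed.

(** * The semigroup as a sum against its kernel *)

Definition delta (y z : V) : R := (z == y)%:R.

Lemma bounded_delta y : bounded_by 1 (delta y).
Proof. by move=> z; rewrite /delta; case: eqP; rewrite ?normr1 ?normr0. Qed.

Lemma sum_delta (s : seq V) f z : uniq s ->
  \sum_(y <- s) f y * delta y z = if z \in s then f z else 0.
Proof.
move=> us; case: ifPn => zs.
  rewrite (bigD1_seq z)//= /delta eqxx mulr1 big1 ?addr0// => y yz.
  by rewrite eq_sym (negbTE yz) mulr0.
rewrite big_seq big1// => y ys; rewrite /delta; case: eqP => [zy|_].
  by rewrite zy ys in zs.
by rewrite mulr0.
Qed.

Lemma bounded_sum_delta (s : seq V) f :
  bounded_by (\sum_(y <- s) `|f y|) (fun z => \sum_(y <- s) f y * delta y z).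
Proof.
move=> z; rewrite (le_trans (ler_norm_sum _ _ _))//; apply: ler_sum => y _.
by rewrite normrM ler_piMr// bounded_delta.
Qed.

(** [P t (delta y) x] is the transition kernel, later identified with $\mu(y)p_t(x,y)$. *)
Lemma semigroup_sum_delta (s : seq V) t f x :
  P t (fun z => \sum_(y <- s) f y * delta y z) x
    = \sum_(y <- s) P t (delta y) x * f y.
Proof.
elim: s => [|y s IH].
  under [X in P t X]eq_fun do rewrite big_nil.
  by rewrite big_nil semigroup_cst.
under [X in P t X]eq_fun do rewrite big_cons -[X in _ + X]mul1r.
rewrite (semigroup_linear _ _ _ _ (bounded_delta y) (bounded_sum_delta s f)).
by rewrite IH big_cons mul1r mulrC.
Qed.

Lemma semigroup_local M t f g x n : 0 <= t ->
  bounded_by M f -> bounded_by M g -> {in iter n hull [:: x], f =1 g} ->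
  `|P t f x - P t g x| <= expR (- (c * t)) * (2 * M * exp_tail (c * t) n).
Proof.
move=> t0 fM gM fg; rewrite /P -mulrBr normrM ger0_norm ?expR_ge0//.
rewrite ler_wpM2l ?expR_ge0//; apply: egf_agree => //.
- exact: geometrically_bounded_iter.
- exact: geometrically_bounded_iter.
move=> j jn; apply: (eq_in_iter_shifted_gen (s := [:: x])); rewrite ?mem_head//.
by move=> y yj; apply: fg; exact: iter_hull_le (ltnW jn) _ yj.
Qed.

(** Finite sums are values of $P_t$ at truncations of [f]. Positivity bounds them by $P_tf$, and
    truncation to growing balls about [x] approaches $P_tf$ by [semigroup_local]. *)
Lemma esum_semigroup M t f x : 0 <= t -> bounded_by M f ->
  (forall y, 0 <= f y) ->
  (\esum_(y in [set: V]) (P t (delta y) x * f y)%:E = (P t f x)%:E)%E.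
Proof.
move=> t0 fM f0.
have M0 := bounded_by_ge0 x fM.
have b0 : bounded_by 0 (fun=> 0 : R) by move=> z; rewrite normr0.
have Pd0 y : 0 <= P t (delta y) x.
  rewrite -[leLHS](semigroup_cst 0 t x).
  by apply: (ler_semigroup _ t0 b0 (bounded_delta y)) => z; exact: ler0n.
have fin_sum (s : seq V) : uniq s -> \sum_(y <- s) P t (delta y) x * f y
    = P t (fun z => if z \in s then f z else 0) x.
  move=> us; rewrite -semigroup_sum_delta; congr (P t _ x).
  by apply/funext => z; rewrite sum_delta.
have rM (s : seq V) : bounded_by M (fun z => if z \in s then f z else 0).
  by move=> z; case: ifP => _; rewrite ?normr0.
have ub : (\esum_(y in [set: V]) (P t (delta y) x * f y)%:E <= (P t f x)%:E)%E.
  apply: ub_ereal_sup => _ [A [finA _] <-].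
  rewrite fsbig_finite//= sumEFin lee_fin fin_sum ?fset_uniq//.
  apply: (ler_semigroup _ t0 (rM _) fM) => z.
  by case: ifP => // _; exact: f0.
apply/eqP; rewrite eq_le ub /=.
have lb0 : (0 <= \esum_(y in [set: V]) (P t (delta y) x * f y)%:E)%E.
  by apply: esum_ge0 => y _; rewrite lee_fin mulr_ge0.
have efin : (\esum_(y in [set: V]) (P t (delta y) x * f y)%:E)%E \is a fin_num.
  by rewrite fin_numElt (lt_le_trans _ lb0) ?ltNyr//= (le_lt_trans ub) ?ltry.
rewrite -(fineK efin) lee_fin -subr_ge0 -oppr_le0 opprB subr_le0.
pose err n := expR (- (c * t)) * (2 * M * exp_tail (c * t) n).
have cerr : P t f x - err n @[n --> \oo] --> P t f x.
  rewrite -[X in _ --> X]subr0; apply: cvgB; first exact: cvg_cst.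
  rewrite -[X in _ --> X](mulr0 (expR (- (c * t)))); apply: cvgMr.
  by rewrite -[X in _ --> X](mulr0 (2 * M)); apply: cvgMr; exact: cvg_exp_tail.
rewrite -[leLHS](cvg_lim _ cerr)//; apply: limr_le.
  by apply/cvg_ex; eexists; exact: cerr.
apply: nearW => n; rewrite -lee_fin fineK//.
apply: esum_ge; pose s := undup (iter n hull [:: x]).
exists [set` s]; first by split => //; exact: finite_seq.
rewrite -fsbig_seq ?undup_uniq//= sumEFin lee_fin fin_sum ?undup_uniq//.
have : {in iter n hull [:: x], f =1 (fun z => if z \in s then f z else 0)}.
  by move=> z zn; rewrite mem_undup zn.
move=> /(semigroup_local t0 fM (rM s)) /ler_normlP[_].
by rewrite -/(err n); lra.
Qed.

(** * Killing outside a set *)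

Section Killed.
Variable I : set V.

Definition killed_gen f := (B (f \_ I)) \_ I.

Lemma bounded_restrict M f : bounded_by M f -> bounded_by M (f \_ I).
Proof.
move=> fM x; have M0 := bounded_by_ge0 x fM.
by rewrite patchE; case: ifP => _; rewrite ?normr0.
Qed.

Lemma geometrically_bounded_killed M f x : bounded_by M f ->
  geometrically_bounded M c (fun j => iter j killed_gen f x).
Proof.
move=> fM j; elim: j x => [|j IH] x; first by rewrite mulr1.
rewrite iterS; apply: bounded_restrict => {}x.
have := geometrically_bounded_iter x (bounded_restrict IH) 1%N.
by rewrite /= expr1 -mulrA -exprSr.
Qed.

Lemma killed_gen_local s f j : (forall x, x \in iter j hull s -> I x) ->
  {in s, iter j killed_gen f =1 iter j B f}.
Proof.
elim: j s => // j IH s sI x xs; rewrite iterS /killed_gen patchE.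
have hI y : y \in hull s -> y \in I.
  move=> ys; rewrite inE; apply: sI; rewrite iterSr.
  exact: (iter_hull_le (leq0n j)).
rewrite hI ?sub_hull// iterS.
apply: (eq_in_iter_shifted_gen (j := 1) (s := s)) => // y ys /=.
rewrite patchE hI//; apply: IH ys => z zs; apply: sI; by rewrite iterSr.
Qed.

End Killed.

(** Once [I k] contains the ball of radius [n] about [x], the first [n] coefficients are those of
    the free series, and the two series differ by at most $2M$ times an exponential tail. *)
Lemma cvg_killed (I : nat -> set V) t f M x : 0 <= t -> bounded_by M f ->
  (forall n, \forall k \near \oo, forall y, y \in iter n hull [:: x] -> I k y) ->
  expR (- (c * t)) * egf (fun j => iter j (killed_gen (I k)) f x) t
    @[k --> \oo] --> P t f x.
Proof.
move=> t0 fM exI; apply: cvgMr.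
apply/cvgrPdist_le => /= e e0.
have ct : 2 * M * exp_tail (c * t) n @[n --> \oo] --> 0.
  by rewrite -[X in _ --> X](mulr0 (2 * M)); apply: cvgMr; exact: cvg_exp_tail.
have /cvgr0_norm_le /(_ _ e0)[n _ /(_ n (leqnn n)) /= ne] := ct.
near=> k.
have Ik y : y \in iter n hull [:: x] -> I k y by move: y; near: k; exact: exI.
rewrite (le_trans _ ne)// (le_trans _ (ler_norm _))//.
apply: egf_agree => //.
- exact: geometrically_bounded_iter.
- exact: geometrically_bounded_killed.
move=> j jn; apply/esym.
apply: (killed_gen_local (s := [:: x])); last exact: mem_head.
move=> y yj; apply: Ik; exact: iter_hull_le (ltnW jn) _ yj.
Unshelve. all: end_near. Qed.

End Generator.

(** * Diagonalization of real symmetric matrices *)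

Section RealSpectralTheorem.
Context {R : rcfType}.

(** Over the algebraic closure there is a left eigenvector $v$ with eigenvalue $z$. Computing
    $vA\bar v^T$ in two ways, [A] being real and symmetric, gives $z|v|^2 = \bar z|v|^2$, so $z$ is
    real. *)
Lemma symmetric_eigenvalue n (A : 'M[R]_n.+1) : A^T = A ->
  exists k : R, eigenvalue A k.
Proof.
move=> symA; pose f := real_complex R.
have [z /eigenvalueP[v vA v0]] : exists z, eigenvalue (map_mx f A) z.
  exact: eigenvalue_closed.
have conjA : map_mx Num.conj (map_mx f A) = map_mx f A.
  by apply/matrixP => i j; rewrite !mxE conj_Creal// complex_real.
pose w := map_mx Num.conj v.
have wA : w *m map_mx f A = z^* *: w.
  by rewrite -[map_mx f A]conjA -map_mxM vA map_mxZ.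
have E : z *: (v *m w^T) = z^* *: (v *m w^T).
  rewrite scalemxAl -vA -mulmxA.
  have -> : map_mx f A *m w^T = (w *m map_mx f A)^T.
    have fA : (map_mx f A)^T = map_mx f A.
      by apply/matrixP => i j; rewrite -[in RHS]symA !mxE.
    by rewrite trmx_mul fA.
  by rewrite wA linearZ /= -scalemxAr.
have N0 : (v *m w^T) 0 0 != 0.
  rewrite mxE; under eq_bigr do rewrite !mxE -normCK.
  rewrite psumr_eq0 => [|i _]; last by rewrite exprn_ge0.
  apply: contraNN v0 => /allP v0; apply/eqP/rowP => i; rewrite mxE.
  by have := v0 i; rewrite mem_index_enum sqrf_eq0 normr_eq0 => /(_ isT)/eqP.
have zr : z \is Num.real.
  apply/CrealP; move/matrixP: E => /(_ 0 0).
  by rewrite mxE [in RHS]mxE => /(mulIf N0).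
have [k kz] : exists k, z = f k.
  by exists (complex.Re z); rewrite /f/= -[LHS]RRe_real.
exists k; have : eigenvalue (map_mx f A) (f k).
  by rewrite -kz; apply/eigenvalueP; exists v.
by rewrite eigenvalue_map.
Qed.

(** Reflection in the hyperplane orthogonal to [v], and the identity for [v = 0]. *)
Definition householder n (v : 'rV[R]_n) : 'M[R]_n :=
  1%:M - (2 / (v *m v^T) 0 0) *: (v^T *m v).

Lemma tr_householder n (v : 'rV[R]_n) : (householder v)^T = householder v.
Proof. by rewrite /householder linearB linearZ /= trmx1 trmx_mul trmxK. Qed.

Lemma row_norm_eq0 n (v : 'rV[R]_n) : ((v *m v^T) 0 0 == 0) = (v == 0).
Proof.
apply/idP/eqP => [|->]; last by rewrite mul0mx mxE.
rewrite mxE; under eq_bigr do rewrite mxE -expr2.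
rewrite psumr_eq0 => [/allP v0|i _]; last exact: sqr_ge0.
apply/rowP => i; rewrite mxE.
by have := v0 i; rewrite mem_index_enum sqrf_eq0 => /(_ isT)/eqP.
Qed.

Lemma householderK n (v : 'rV[R]_n) : householder v *m householder v = 1%:M.
Proof.
rewrite /householder; set s := (v *m v^T) 0 0.
have [s0|s0] := eqVneq s 0.
  by rewrite s0 invr0 mulr0 scale0r subr0 mulmx1.
have E : (v^T *m v) *m (v^T *m v) = s *: (v^T *m v).
  rewrite mulmxA -[v^T *m v *m v^T]mulmxA [v *m v^T]mx11_scalar -/s.
  by rewrite mul_mx_scalar -scalemxAl.
move: (v^T *m v) E => M E.
rewrite mulmxBl mul1mx -scalemxAl mulmxBr mulmx1 -scalemxAr E scalerA.
by apply/matrixP => i j; rewrite !mxE; field.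
Qed.

(** Equal norms give $2\langle u, u-v\rangle = |u-v|^2$, so reflecting along $u-v$ subtracts exactly
    $u-v$ from $u$. *)
Lemma householder_reflect n (u v : 'rV[R]_n) :
  (u *m u^T) 0 0 = (v *m v^T) 0 0 -> u *m householder (u - v) = v.
Proof.
move=> uv; rewrite /householder; set w := u - v; set s := (w *m w^T) 0 0.
have [s0|s0] := eqVneq s 0.
  rewrite s0 invr0 mulr0 scale0r subr0 mulmx1; apply/eqP; rewrite -subr_eq0.
  by rewrite -row_norm_eq0 -/w -/s s0.
have vu : (v *m u^T) 0 0 = (u *m v^T) 0 0.
  by rewrite -[v *m u^T]trmxK trmx_mul trmxK mxE.
have E : 2 * (u *m w^T) 0 0 = s.
  rewrite /s /w linearB /= !mulmxBr !mulmxBl.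
  move: uv vu; move: (u *m u^T) (v *m v^T) (u *m v^T) (v *m u^T) => a b d e.
  by move=> ab ed; rewrite !mxE ab ed; ring.
rewrite mulmxBr mulmx1 -scalemxAr mulmxA [u *m w^T]mx11_scalar mul_scalar_mx.
rewrite scalerA mulrAC E divff// scale1r /w.
by apply/matrixP => i j; rewrite !mxE; ring.
Qed.

(** Deflation: a reflection takes a unit eigenvector to the first basis vector; by symmetry the
    conjugated matrix is then block diagonal, with a smaller symmetric block for the induction. The
    rows of [P] form an orthonormal eigenbasis. *)
Theorem symmetric_diagonalization n (A : 'M[R]_n) : A^T = A ->
  exists (P : 'M[R]_n) (d : 'rV[R]_n),
    P *m P^T = 1%:M /\ P *m A = diag_mx d *m P.
Proof.
elim: n A => [|n IH] A symA.
  by exists 1%:M, 0; split; apply/matrixP => -[].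
have [k /eigenvalueP[v vA v0]] := symmetric_eigenvalue symA.
pose r := Num.sqrt ((v *m v^T) 0 0).
have vv0 : 0 <= (v *m v^T) 0 0.
  by rewrite mxE; apply: sumr_ge0 => i _; rewrite mxE -expr2 sqr_ge0.
have r0 : r != 0.
  by rewrite sqrtr_eq0 -ltNge lt_neqAle vv0 andbT eq_sym row_norm_eq0.
pose u := r^-1 *: v; pose e : 'rV[R]_n.+1 := delta_mx 0 0.
have uA : u *m A = k *: u by rewrite -scalemxAl vA scalerA mulrC -scalerA.
have uu : (u *m u^T) 0 0 = (e *m e^T) 0 0.
  rewrite trmx_delta mul_delta_mx [in RHS]mxE !eqxx.
  rewrite /u linearZ /= -scalemxAl -scalemxAr !scalerA mxE.
  by rewrite -[X in _ * X](sqr_sqrtr vv0) -/r; field.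
pose H := householder (e - u).
have eH : e *m H = u by exact: householder_reflect.
have uH : u *m H = e by rewrite -eH -mulmxA householderK mulmx1.
pose A1 : 'M[R]_(1 + n) := H *m A *m H.
have symA1 : A1^T = A1 by rewrite /A1 !trmx_mul tr_householder symA mulmxA.
have eA1 : e *m A1 = k *: e by rewrite !mulmxA eH uA -scalemxAl uH.
have rowA1 : row 0 A1 = k *: e by rewrite rowE.
pose B := drsubmx A1.
have EA1 : A1 = block_mx k%:M 0 0 B.
  have ur : ursubmx A1 = 0.
    apply/matrixP => i j; move/rowP: rowA1 => /(_ (rshift 1 j)).
    rewrite !mxE !ord1 (_ : lshift n 0 = 0)// => [->|]; last exact/val_inj.
    by rewrite /= mulr0.
  rewrite -[LHS]submxK; congr block_mx => //.
    apply/matrixP => i j; move/rowP: rowA1 => /(_ 0).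
    rewrite !mxE !ord1 !eqxx mulr1n mulr1.
    by rewrite (_ : lshift n 0 = 0)//; apply/val_inj.
  by rewrite -[LHS]trmxK trmx_dlsub symA1 ur trmx0.
have symB : B^T = B by rewrite trmx_drsub symA1.
have [Q [d [QQ QB]]] := IH _ symB.
pose S : 'M[R]_(1 + n) := block_mx 1%:M 0 0 Q.
have SS : S *m S^T = 1%:M.
  rewrite /S tr_block_mx !trmx0 trmx1 mulmx_block !mul1mx !mul0mx !mulmx0 QQ.
  by rewrite !addr0 add0r -scalar_mx_block.
have SA1 : S *m A1 = diag_mx (row_mx k%:M d) *m S.
  rewrite EA1 /S diag_mx_row !mulmx_block !mul1mx !mul0mx !mulmx0 !mulmx1.
  rewrite !addr0 !add0r QB; congr block_mx.
  by apply/matrixP => i j; rewrite !mxE !ord1.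
exists (S *m H), (row_mx k%:M d : 'rV_(1 + n)); split.
  rewrite trmx_mul tr_householder mulmxA -[S *m H *m H]mulmxA householderK mulmx1.
  exact: SS.
have HA : H *m A = A1 *m H 
  by rewrite -[RHS]/((H *m A *m H) *m H) -[RHS]mulmxA householderK mulmx1.
by rewrite -mulmxA HA mulmxA SA1 mulmxA.
Qed.

End RealSpectralTheorem.

(** * Identification of the heat semigroup *)

Section HeatSemigroup.
Context {R : realType} {V : choiceType}.
Variables (w : V -> V -> R) (mu : V -> R) (c : R).
Hypothesis graph : weighted_graph w mu.
Hypothesis c_ge0 : 0 <= c.
Hypothesis degree_ratio_le : forall x, degree w x / mu x <= c.

Let N x : seq V := enum_fset (fset_set (neighbours w x)).
Let a x y := w x y / mu x.

Let mu0 x : 0 < mu x := vertex_measure_gt0 graph x.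

Lemma mem_nbr x y : (y \in N x) = (0 < w x y).
Proof.
rewrite -[LHS]/(y \in fset_set (neighbours w x)) in_fset_set; last first.
  exact: locally_finite graph x.
by apply/idP/idP => [/set_mem|/mem_set].
Qed.

Let a_ge0 x y : 0 <= a x y.
Proof. by rewrite divr_ge0 ?(weight_ge0 graph)// ltW. Qed.

Lemma sum_nbrE x (F : V -> R) :
  \sum_(y \in neighbours w x) F y = \sum_(y <- N x) F y.
Proof. by rewrite fsbig_finite//; exact: locally_finite graph x. Qed.

Lemma sum_rates_le x : \sum_(y <- N x) a x y <= c.
Proof.
by rewrite -mulr_suml; have := degree_ratio_le x; rewrite /degree sum_nbrE.
Qed.

Local Notation L := (gen N a).
Local Notation P := (semigroup N a c).
Local Notation Gam := (carre_du_champ N a).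

Lemma laplacianE f : laplacian w mu f = L f.
Proof.
apply/funext => x; rewrite /laplacian sum_nbrE mulr_sumr.
by apply: eq_bigr => y _; rewrite /a; ring.
Qed.

Lemma GammaE f g : Gamma w mu f g = Gam f g.
Proof.
apply/funext => x; rewrite /Gamma !laplacianE /gen /carre_du_champ; congr (_ * _).
by rewrite !mulr_sumr -!sumrB; apply: eq_bigr => y _; ring.
Qed.

Lemma CDE'E K : CDE' w mu +oo%E (- K) <-> curvature_ge N a K.
Proof.
rewrite /CDE' /curvature_ge; split=> H f f0 x; have := H f f0 x;
  by rewrite /Gamma2_tilde invey /= !mul0r add0r !GammaE !laplacianE.
Qed.

Lemma dirichlet_laplacianE U f :
  dirichlet_laplacian w mu U f = (L (f \_ (inner w U))) \_ (inner w U).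
Proof. by rewrite /dirichlet_laplacian laplacianE. Qed.

(** * Dirichlet eigenbasis and heat kernel of a finite set *)

Section Eigenbasis.
Variable U : set V.
Hypothesis finU : finite_set U.

Let I := inner w U.

Let finI : finite_set I.
Proof. by apply: sub_finite_set finU => x []. Qed.

Let s := enum_fset (fset_set I).
Let n := size s.
Let e (i : 'I_n) : V := tnth (in_tuple s) i.

Let e_inj : injective e.
Proof. by apply/tuple_uniqP; exact: fset_uniq. Qed.

Let eI i : I (e i).
Proof. by have := mem_tnth i (in_tuple s); rewrite in_fset_set// => /set_mem. Qed.

Let e_surj x : I x -> exists i, x = e i.
Proof.
move=> Ix; have : x \in in_tuple s by rewrite /= in_fset_set//; exact: mem_set.
by move=> /tnthP.
Qed.

Let sum_I (F : V -> R) : \sum_(x \in I) F x = \sum_(i < n) F (e i).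
Proof. by rewrite fsbig_finite//= big_tnth. Qed.

(** This is $-\Delta_U$ in the orthonormal basis $\delta_{e_i}/\sqrt{\mu(e_i)}$, a normalization
    that makes the matrix symmetric. *)
Let M : 'M[R]_n := \matrix_(i, j)
  ((degree w (e i) * (i == j)%:R - w (e i) (e j)) / Num.sqrt (mu (e i) * mu (e j))).

Let symM : M^T = M.
Proof.
apply/matrixP => i j; rewrite !mxE (weight_sym graph (e j)) [mu (e j) * _]mulrC.
by rewrite eq_sym; case: eqP => [->//|_]; rewrite !mulr0.
Qed.

Lemma dirichlet_eigenbasis_exists :
  exists (lambda : 'I_n -> R) (phi : 'I_n -> V -> R),
    dirichlet_eigenbasis w mu U lambda phi.
Proof.
have [Q [d [QQ QM]]] := symmetric_diagonalization symM.
(* $QQ^T = 1$ will give orthonormality, and $Q^TQ = 1$ completeness. *)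
have QQ' : Q^T *m Q = 1%:M by exact: mulmx1C.
pose sm k := Num.sqrt (mu (e k)).
have sm0 k : sm k != 0 by rewrite sqrtr_eq0 -ltNge.
have smE k : mu (e k) = sm k ^+ 2 by rewrite sqr_sqrtr// ltW.
(* Row [i] of [Q], divided by $\sqrt\mu$ to return from the orthonormal basis to functions, and
   extended by 0. *)
pose phi i x := \sum_k Q i k / sm k * delta (e k) x : R.
have phiE i k : phi i (e k) = Q i k / sm k.
  rewrite /phi (bigD1 k)//= /delta eqxx mulr1 big1 ?addr0// => l lk.
  by rewrite (inj_eq e_inj) eq_sym (negbTE lk) mulr0.
have phi0 i x : ~ I x -> phi i x = 0.
  move=> Ix; rewrite /phi big1// => k _; rewrite /delta.
  by case: eqP => [xe|_]; [exfalso; apply: Ix; rewrite xe|rewrite mulr0].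
exists (d 0), phi; split.
- exact: phi0.
- move=> i x; rewrite dirichlet_laplacianE -/I.
  have -> : phi i \_ I = phi i.
    apply/funext => y; rewrite patchE; case: ifPn => //; rewrite notin_setE.
    by move=> /phi0 ->.
  rewrite patchE; case: ifPn => [|]; last first.
    by rewrite notin_setE => /phi0 ->; rewrite oppr0 mulr0.
  move=> /set_mem /e_surj[k ->].
  have sumw l : \sum_(y <- N (e k)) w (e k) y * delta (e l) y = w (e k) (e l).
    under eq_bigr do rewrite /delta eq_sym.
    rewrite sum_delta ?fset_uniq// mem_nbr; case: ltP => // w0.
    by apply/eqP; rewrite eq_le w0 (weight_ge0 graph).
  pose W := \sum_l Q i l / sm l * w (e k) (e l).
  have -> : L (phi i) (e k) = (W - degree w (e k) * phi i (e k)) / mu (e k).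
    rewrite /W /degree sum_nbrE mulr_suml.
    under eq_bigr do rewrite -sumw mulr_sumr.
    rewrite exchange_big /= -sumrB mulr_suml; apply: eq_bigr => y _.
    rewrite /a mulrAC mulrBr; congr ((_ - _) / _); rewrite /phi mulr_sumr.
    by apply: eq_bigr => l _; ring.
  have : \sum_l Q i l * M l k = d 0 i * Q i k.
    have := congr1 (fun A : 'M[R]_n => A i k) QM.
    by rewrite mul_diag_mx mxE [RHS]mxE.
  have -> : \sum_l Q i l * M l k
      = degree w (e k) * Q i k / sm k ^+ 2 - W / sm k.
    rewrite /W mulr_suml (bigD1 k)//= [X in _ - X](bigD1 k)//= opprD addrA.
    rewrite -sumrN; congr (_ + _).
      rewrite mxE eqxx mulr1 sqrtrM ?(ltW (mu0 _))// -/(sm k).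
      by field.
    apply: eq_bigr => l lk; rewrite mxE (negbTE lk) mulr0 sub0r.
    rewrite sqrtrM ?(ltW (mu0 _))// -/(sm k) -/(sm l) (weight_sym graph (e l)).
    by field; rewrite ?sm0.
  rewrite phiE smE => E; rewrite [RHS]mulrA -E; field; exact: sm0.
- move=> i j; rewrite /inner_product -/I sum_I.
  have := congr1 (fun A : 'M[R]_n => A i j) QQ; rewrite !mxE => <-.
  by apply: eq_bigr => k _; rewrite !phiE smE mxE; field.
(* The coefficients are the inner products of [f] with [phi i], since $\mu f\phi_i = f\sqrt\mu\,Q_i$
   at each vertex. *)
- move=> f f0; exists (fun i => \sum_k f (e k) * sm k * Q i k) => x.
  have [Ix|Ix] := pselect (I x); last first.
    by rewrite f0// big1// => i _; rewrite phi0// mulr0.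
  have [l ->] := e_surj Ix.
  under eq_bigr do rewrite phiE mulr_suml.
  rewrite exchange_big /=.
  have E k : \sum_i f (e k) * sm k * Q i k * (Q i l / sm l) =
      f (e k) * sm k / sm l * (k == l)%:R.
    have := congr1 (fun A : 'M[R]_n => A k l) QQ'; rewrite !mxE => <-.
    by rewrite mulr_sumr; apply: eq_bigr => i _; rewrite mxE; field.
  under eq_bigr do rewrite E.
  rewrite (bigD1 l)//= eqxx mulr1 big1 ?addr0; first by rewrite mulfK.
  by move=> k /negbTE ->; rewrite mulr0.
Qed.

Local Notation killed := (killed_gen N a c I).

Lemma killed_genE f x : (forall y, ~ I y -> f y = 0) ->
  killed f x = dirichlet_laplacian w mu U f x + c * f x.
Proof.
move=> f0; have fI : f \_ I = f.
  apply/funext => y; rewrite patchE; case: ifPn => //; rewrite notin_setE.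
  by move=> /f0 ->.
rewrite /killed_gen dirichlet_laplacianE -/I fI !patchE; case: ifPn => //.
by rewrite notin_setE => /f0 ->; rewrite mulr0 addr0.
Qed.

(** In the eigenbasis [delta y] has coefficients $\mu(y)\phi_i(y)$ and the killed operator acts by
    $c - \lambda_i$, so its exponential series sums to $\mu(y)e^{ct}p_U(t,x,y)$. The right side is
    free of the eigenbasis, so the kernel does not depend on its choice. *)
Lemma dirichlet_heat_kernelE p t x y : is_dirichlet_heat_kernel w mu U p ->
  I y ->
  p t x y = (expR (- (c * t)) * egf (fun j => iter j killed (delta y) x) t) / mu y.
Proof.
move=> [m [lam [phi [[phi0 eig ortho compl] pE]]]] Iy.
have my0 : mu y != 0 by rewrite gt_eqF.
have [b bE] : exists b : 'I_m -> R,
    forall z, delta y z = \sum_(i < m) b i * phi i z.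
  apply: compl => z Iz; rewrite /delta; case: eqP => // zy.
  by exfalso; apply: Iz; rewrite zy.
have {}bE z : delta y z = \sum_(i < m) mu y * phi i y * phi i z.
  rewrite bE; apply: eq_bigr => i _; congr (_ * _).
  have : inner_product mu I (delta y) (phi i) = mu y * phi i y.
    rewrite /inner_product fsbig_finite//= (bigD1_seq y)/= ?fset_uniq//; last first.
      by rewrite in_fset_set//; exact: mem_set.
    rewrite big1 ?addr0 => [|z' z'y]; first by rewrite /delta eqxx mulr1.
    by rewrite /delta (negbTE z'y) mulr0 mul0r.
  move=> <-; rewrite /inner_product fsbig_finite//.
  under eq_bigr do rewrite bE mulr_sumr mulr_suml.
  rewrite exchange_big /= (bigD1 i)//= [X in _ = _ + X]big1 => [|j ji].
    rewrite addr0; have := ortho i i.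
    rewrite eqxx /inner_product fsbig_finite//= => E.
    rewrite -[LHS]mulr1 -[X in _ * X]/(true%:R) -E mulr_sumr.
    by apply: eq_bigr => z' _; ring.
  have := ortho j i; rewrite (negbTE ji) /inner_product fsbig_finite//= => E.
  rewrite -[RHS](mulr0 (b j)) -[X in _ * X]/(false%:R) -E mulr_sumr.
  by apply: eq_bigr => z' _; ring.
have killed_sum (k : 'I_m -> R) : killed (fun z => \sum_(i < m) k i * phi i z)
    = (fun z => \sum_(i < m) (c - lam i) * k i * phi i z).
  apply/funext => z; rewrite killed_genE => [|z' Iz']; last first.
    by rewrite big1// => i _; rewrite phi0 ?mulr0.
  have [Iz|Iz] := pselect (I z); last first.
    rewrite /dirichlet_laplacian patchE ifN ?notin_setE// add0r.
    by rewrite !big1 ?mulr0// => i _; rewrite phi0// mulr0.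
  have dirI f : (forall z, ~ I z -> f z = 0) ->
      dirichlet_laplacian w mu U f z = L f z.
    move=> f0; rewrite dirichlet_laplacianE patchE ifT; last exact: mem_set.
    congr (L _ z); apply/funext => z'; rewrite patchE; case: ifPn => //.
    by rewrite notin_setE => /f0.
  rewrite dirI => [|z' Iz']; last by rewrite big1// => i _; rewrite phi0// mulr0.
  rewrite /gen; under eq_bigr do rewrite -sumrB mulr_sumr.
  rewrite exchange_big /= mulr_sumr -big_split /=; apply: eq_bigr => i _.
  have := eig i z; rewrite dirI; last exact: phi0.
  move=> /(canRL opprK) E.
  transitivity (k i * L (phi i) z + c * (k i * phi i z)); last by rewrite E; ring.
  by rewrite /gen mulr_sumr; congr (_ + _); apply: eq_bigr => z' _; ring.
have iterE j z : iter j killed (delta y) z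
    = \sum_(i < m) (mu y * phi i y * phi i z) * (c - lam i) ^+ j.
  elim: j z => [|j IH] z.
    by rewrite [LHS]bE; apply: eq_bigr => i _; rewrite mulr1.
  rewrite iterS (_ : iter j _ _ = fun z => \sum_(i < m)
      (mu y * phi i y * (c - lam i) ^+ j) * phi i z); last first.
    by apply/funext => z'; rewrite IH; apply: eq_bigr => i _; ring.
  by rewrite killed_sum; apply: eq_bigr => i _; rewrite exprS; ring.
(* A common geometric rate for the powers of all the [c - lam i]. *)
pose C := \sum_(i < m) `|c - lam i|.
have gb i : geometrically_bounded 1 C (fun j => (c - lam i) ^+ j).
  move=> j; rewrite mul1r normrX lerXn2r ?nnegrE//; first exact: sumr_ge0.
  by rewrite /C (bigD1 i)//= lerDl sumr_ge0.
have C0 : 0 <= C by exact: sumr_ge0.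
rewrite (_ : (fun j => _) = (fun j => \sum_(i < m)
    (mu y * phi i y * phi i x) * (c - lam i) ^+ j)); last first.
  by apply/funext => j; exact: iterE.
rewrite (egf_sum _ _ _ C0 gb) pE mulr_sumr mulr_suml; apply: eq_bigr => i _.
rewrite egf_geom (_ : - lam i * t = - (c * t) + (c - lam i) * t); last by ring.
by rewrite expRD; field.
Qed.

Lemma dirichlet_heat_kernelP :
  is_dirichlet_heat_kernel w mu U (dirichlet_heat_kernel w mu U).
Proof.
apply: (@xgetPex _ _ [set p | is_dirichlet_heat_kernel w mu U p]).
have [lam [phi H]] := dirichlet_eigenbasis_exists.
by eexists; exists n, lam, phi; split; [exact: H|move=> t x y; reflexivity].
Qed.

End Eigenbasis.

(** * Limits along exhaustions *)

Lemma cvg_dirichlet_heat_kernel U (t : R) x y : exhaustion w U -> 0 <= t ->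
  dirichlet_heat_kernel w mu (U k) t x y @[k --> \oo] --> P t (delta y) x / mu y.
Proof.
move=> [finU subU covU] t0.
(* A vertex of [U m] is interior to [U m.+1] and to all later sets, since the sets increase. *)
have ev z : \forall k \near \oo, inner w (U k) z.
  have [m _ Um] : (\bigcup_k U k) z by rewrite covU.
  exists m.+1 => // k /= mk.
  have Uk : forall j, U (m + j)%N z.
    by elim=> [|j IH]; rewrite ?addn0// addnS; have [] := subU _ _ IH.
  have -> : k = (m + (k - m.+1)).+1 by rewrite -addSn subnKC.
  exact: subU.
have evs (s : seq V) : \forall k \near \oo, forall z, z \in s -> inner w (U k) z.
  elim: s => [|z s IH]; first by near=> k.
  near=> k; move=> z'; rewrite inE => /orP[/eqP ->|]; first by near: k; exact: ev.
  by move: z'; near: k.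
have : expR (- (c * t)) * egf (fun j =>
    iter j (killed_gen N a c (inner w (U k))) (delta y) x) t / mu y
    @[k --> \oo] --> P t (delta y) x / mu y.
  apply: cvgMl.
  apply: (cvg_killed c_ge0 a_ge0 sum_rates_le t0 (bounded_delta y)) => k.
  exact: evs.
apply: cvg_trans; apply: near_eq_cvg; near=> k.
rewrite (dirichlet_heat_kernelE (finU k) t x (dirichlet_heat_kernelP (finU k)))//.
by near: k; exact: ev.
Unshelve. all: end_near. Qed.

(** Balls about [x0] cover [V] by connectedness. Some exhaustion has to be exhibited for the limit
    defining [heat_kernel] to be unique. *)
Lemma exhaustion_hull x0 : exhaustion w (fun k => [set` iter k (hull N) [:: x0]]).
Proof.
split=> [k|k x /= xk|]; first exact: finite_seq.
  split => /=; first exact: sub_hull.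
  by move=> y xy; apply: (nbr_hull xk); rewrite mem_nbr.
apply/seteqP; split=> // x _.
have [s [ps <-]] := graph_connected graph x0 x.
exists (size s) => //=.
elim/last_ind: s ps => [|s z IH]; first by rewrite mem_head.
rewrite rcons_path last_rcons size_rcons => /andP[/IH H wz].
by apply: (nbr_hull H); rewrite mem_nbr.
Qed.

Lemma heat_kernelE (t : R) x y : 0 <= t ->
  heat_kernel w mu t x y = P t (delta y) x / mu y.
Proof.
move=> t0; apply: xget_unique => [U exU|l H].
  exact: cvg_dirichlet_heat_kernel.
have exh := exhaustion_hull x.
rewrite -(cvg_lim _ (H _ exh))//.
by rewrite -(cvg_lim _ (cvg_dirichlet_heat_kernel exh t0)).
Qed.

(** As [f] and the kernel are nonnegative, the negative part in [real_sum] contributes 0 and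
    [esum_semigroup] evaluates the positive one. *)
Lemma heat_semigroupE M (t : R) f x : 0 <= t -> bounded_by M f ->
  (forall y, 0 <= f y) ->
  heat_semigroup w mu t f x = P t f x.
Proof.
move=> t0 fM f0; rewrite /heat_semigroup; case: eqP => [->|_].
  by rewrite (semigroup0 c_ge0 a_ge0 sum_rates_le x fM).
have b0 : bounded_by (V := V) 0 (fun=> 0 : R) by move=> z; rewrite /= normr0.
have Pd0 y : 0 <= P t (delta y) x.
  rewrite -[leLHS](semigroup_cst N a c 0 t x).
  apply: (ler_semigroup c_ge0 a_ge0 sum_rates_le _ t0 b0 (bounded_delta y)).
  by move=> z; exact: ler0n.
have E y : mu y * heat_kernel w mu t x y * f y = P t (delta y) x * f y.
  by rewrite heat_kernelE//; field; rewrite gt_eqF.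
rewrite /real_sum.
rewrite (_ : (\esum_(y in _) _)%E = (P t f x)%:E); last first.
  rewrite -(esum_semigroup c_ge0 a_ge0 sum_rates_le x t0 fM f0).
  by apply: eq_esum => y _; rewrite E max_l// mulr_ge0.
rewrite esum1 ?sube0// => y _.
by rewrite E max_r// oppr_le0 mulr_ge0.
Qed.

End HeatSemigroup.

(** * The equivalence for weighted graphs *)

Lemma max_degree_ratio_bound (R : realType) (V : choiceType)
    (w : V -> V -> R) (mu : V -> R) : weighted_graph w mu ->
  exists2 c : R, 0 <= c & forall x, degree w x / mu x <= c.
Proof.
move=> graph; have := max_degree_ratio_lty graph.
have ub x : ((degree w x / mu x)%:E <= max_degree_ratio w mu)%E.
  by apply: ereal_sup_ubound; exists x.
case E : (max_degree_ratio w mu) ub => [c| |] ub // _.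
  exists (Num.max 0 c) => [|x]; rewrite le_max ?lexx//.
  by move: (ub x); rewrite lee_fin => ->; rewrite orbT.
(* The supremum is $-\infty$ only when [V] is empty. *)
by exists 0 => // x; have := ub x.
Qed.

Lemma bounded_fun_bounded_by (R : realType) (V : choiceType) (f : V -> R) :
  bounded_fun f -> exists M, bounded_by M f.
Proof.
move=> [M [_ H]]; exists (M + 1) => x; apply: (H (M + 1)) => //.
by rewrite ltrDl.
Qed.

Lemma bounded_by_bounded_fun (R : realType) (V : choiceType) (f : V -> R) M :
  bounded_by M f -> bounded_fun f.
Proof.
move=> fM; exists M; split; first exact: num_real.
by move=> M' MM' x _ /=; rewrite (le_trans (fM x))// ltW.
Qed.

(** The requirement $e \le 1 \le M$ lets the bounds survive the replacement of [f] by 1 outside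
    [s]. *)
Lemma seq_bounds (R : realType) (V : choiceType) (f : V -> R) (s : seq V) :
  (forall x, 0 < f x) ->
  exists e M, [/\ 0 < e, e <= 1, 1 <= M & {in s, forall x, e <= f x <= M}].
Proof.
move=> f0; elim: s => [|y s [e [M [e0 e1 M1 H]]]]; first by exists 1, 1; split.
exists (Num.min e (f y)), (Num.max M (f y)); split.
- by rewrite lt_min e0 f0.
- by rewrite ge_min e1.
- by rewrite le_max M1.
move=> x; rewrite inE ge_min le_max => /orP[/eqP ->|/H/andP[-> ->]//].
by rewrite lexx !orbT.
Qed.

Theorem theorem3p4 (R : realType) (V : choiceType)
    (w : V -> V -> R) (mu : V -> R) (K : R) :
  weighted_graph w mu ->
  (CDE' w mu +oo%E (- K) <->
   forall f : V -> R, (forall x, 0 < f x) -> bounded_fun f ->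
   forall t : R, 0 <= t -> forall x : V,
     Gamma w mu (fun y => Num.sqrt (heat_semigroup w mu t f y))
                (fun y => Num.sqrt (heat_semigroup w mu t f y)) x
     <= expR (2 * K * t) *
        heat_semigroup w mu t
          (Gamma w mu (fun y => Num.sqrt (f y)) (fun y => Num.sqrt (f y))) x).
Proof.
move=> graph; have [c c0 cdeg] := max_degree_ratio_bound graph.
pose N x : seq V := enum_fset (fset_set (neighbours w x)).
pose a x y := w x y / mu x.
have a0 x y : 0 <= a x y.
  by rewrite divr_ge0 ?(weight_ge0 graph)// ltW// (vertex_measure_gt0 graph).
have ac x : \sum_(y <- N x) a x y <= c by exact: sum_rates_le.
have heatE (f : V -> R) (t : R) x : (forall y, 0 < f y) -> bounded_fun f -> 0 <= t ->
    (Gamma w mu (fun y => Num.sqrt (heat_semigroup w mu t f y))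
                (fun y => Num.sqrt (heat_semigroup w mu t f y)) x
     <= expR (2 * K * t) * heat_semigroup w mu t
          (Gamma w mu (fun y => Num.sqrt (f y)) (fun y => Num.sqrt (f y))) x)
    = (carre_sqrt N a (semigroup N a c t f) x
       <= expR (2 * K * t) * semigroup N a c t (carre_sqrt N a f) x).
  move=> f0 /bounded_fun_bounded_by[M fM] t0.
  have M0 := bounded_by_ge0 x fM.
  rewrite !(GammaE graph) (heat_semigroupE graph c0 cdeg _ t0
    (bounded_carre_sqrt a0 ac M0 fM)) => [|y]; last exact: carre_du_champ_ge0.
  rewrite (_ : heat_semigroup w mu t f = semigroup N a c t f)//.
  by apply/funext => y; apply: heat_semigroupE fM _ => // z; exact: ltW.
rewrite (CDE'E graph); split=> [cK f f0 bf t t0 x|H f f0 x].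
  rewrite heatE//; have [M fM] := bounded_fun_bounded_by bf.
  exact: carre_sqrt_semigroup cK t0 f0 fM.
(* Radius 2, because [gen] at [x] is applied to functions that themselves involve neighbours. *)
pose s := iter 2 (hull N) [:: x].
have [e [M [e0 e1 M1 sf]]] := seq_bounds s f0.
pose g y := if y \in s then f y else 1.
have gI y : e <= g y <= M by rewrite /g; case: ifP => [/sf//|_]; rewrite e1 M1.
(* The gradient estimate concerns square roots, so it is applied to the square of [g], which is
   bounded and bounded away from 0. *)
pose u y := g y ^+ 2.
have g0 y : 0 < g y by case/andP: (gI y) => /(lt_le_trans e0).
have sqrtu : (fun y => Num.sqrt (u y)) = g.
  by apply/funext => y; rewrite sqrtr_sqr ger0_norm// ltW.
have eu y : e ^+ 2 <= u y.
  by rewrite ler_sqr ?nnegrE ?(ltW e0) ?(ltW (g0 y))//; case/andP: (gI y).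
have uM : bounded_by (M ^+ 2) u.
  move=> y; rewrite ger0_norm ?sqr_ge0// ler_sqr ?nnegrE ?(ltW (g0 y))//.
    by case/andP: (gI y).
  exact: le_trans M1.
have u0 y : 0 < u y by rewrite exprn_gt0.
have curv : - K * carre_sqrt N a u x
    <= 2^-1 * gen N a (carre_sqrt N a u) x - drift N a u x.
  apply: (curvature_of_semigroup c0 a0 ac (exprn_gt0 2 e0) eu uM) => t t0.
  have bu := bounded_by_bounded_fun uM.
  by rewrite -heatE// ?(ltW t0)//; apply: H => //; exact: ltW.
have fg : {in iter 2 (hull N) [:: x], g =1 f} by move=> y ys; rewrite /g ys.
have fg1 : {in hull N [:: x], g =1 f}.
  by move=> y ys; apply: fg; exact: (iter_hull_le (m := 1)).
have xs : x \in [:: x] by exact: mem_head.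
have Gfg : {in hull N [:: x], carre_du_champ N a g g =1 carre_du_champ N a f f}.
  exact: (eq_in_carre_du_champ a fg fg).
(* Locality turns the curvature inequality for [g] at [x] into the one for [f]. *)
move: curv; rewrite /carre_sqrt /drift sqrtu.
rewrite (eq_in_gen a Gfg xs) (Gfg x) ?sub_hull//.
rewrite (eq_in_carre_du_champ a fg1 (g' := fun y =>
  gen N a (fun z => f z ^+ 2) y / (2 * f y)) _ xs)// => y ys.
have -> : Num.sqrt (u y) = f y by rewrite -fg1// -sqrtu.
rewrite (eq_in_gen a (s := hull N [:: x]) (g := fun z => f z ^+ 2))// => z zs.
by rewrite /u fg.
Qed.
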